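(* There exist universal constants $C_0>0$ and $n_0\geq 1$ such that for every $n\geq n_0$, every partition $\lambda\vdash n$ and every permutation $\sigma\in\mathfrak{S}_n\setminus\{\mathrm{Id}\}$, $$|\chi^\lambda(\sigma)|\leq \left(\frac{C_0}{\sqrt{|\sigma|}}\right)^{|\sigma|}\max\left(1,\frac{s(\lambda)\sqrt{|\sigma|}}{n}\right)^{\mathrm{supp}(\sigma)}.$$
   Context: $\mathfrak{S}_n$ is the symmetric group on $n$ elements. Irreducible complex representations of $\mathfrak{S}_n$ are indexed in the usual way by partitions $\lambda\vdash n$ (with $[n]$ corresponding to the trivial representation); $d_\lambda$ is the dimension and $\mathrm{ch}^\lambda$ the character of the representation $\lambda$, and $\chi^\lambda(\sigma):=\mathrm{ch}^\lambda(\sigma)/d_\lambda$ is the normalized character. For $\sigma\in\mathfrak{S}_n$, $|\sigma|$ is the minimal number of transpositions whose product is $\sigma$, and $\mathrm{supp}(\sigma)$ is the support size, i.e. the number of non-fixed points of $\sigma$. For a partition $\lambda$, $\lambda_1$ is the length of its first row, $\lambda_1'$ the length of its first column, and $s(\lambda):=\lambda_1+\lambda_1'-1$ is its maximal hook length. *)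

(* Defs.v *)
From HB Require Import structures.
From mathcomp Require Import all_boot all_order all_algebra.
From mathcomp Require Import all_fingroup all_solvable all_field all_character.

Set Implicit Arguments.
Unset Strict Implicit.
Unset Printing Implicit Defensive.

Import Order.TTheory GRing.Theory Num.Theory.
Local Open Scope ring_scope.

Definition is_part (n : nat) (la : seq nat) : bool :=
  [&& sorted geq la, 0%N \notin la & sumn la == n].

(* As the parts are nonzero, [size la] is the length of the first column. *)
Definition max_hook (la : seq nat) : nat := (head 0%N la + size la - 1)%N.

Section Permutations.
Variable T : finType.
Implicit Types s : {perm T}.

Definition supp_size s : nat := #|[set x | s x != x]|.

Definition is_prod_of_transpositions s (k : nat) : bool :=
  [exists ts : k.-tuple (T * T),
     all dpair ts && (s == (\prod_(t <- ts) tperm t.1 t.2)%g)].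

Lemma ex_prod_of_transpositions s : exists k, is_prod_of_transpositions s k.
Proof.
have [ts -> dts] := prod_tpermP s.
by exists (size ts); apply/existsP; exists (in_tuple ts); rewrite dts eqxx.
Qed.

Definition perm_len s : nat := ex_minn (ex_prod_of_transpositions s).

End Permutations.

Section Specht.
Variables (n : nat) (la : seq nat).

(* The canonical tableau of shape la: its boxes are numbered 0, ..., n - 1 in
   reading order, and box x lies in row [reshape_index la x] and column
   [reshape_offset la x]. *)
Definition row_stab : {set 'S_n} :=
  [set p : 'S_n | [forall x, reshape_index la (p x) == reshape_index la x]].

Definition col_stab : {set 'S_n} :=
  [set q : 'S_n | [forall x, reshape_offset la (q x) == reshape_offset la x]].

Local Notation aG := (regular_repr algC [set: 'S_n]%G).

(* The product a_la b_la of the row symmetrizer and the column antisymmetrizer,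
   as an element of the group algebra acting by right multiplication. *)
Definition young_symmetrizer : 'M[algC]_#|[set: 'S_n]%G| :=
  (\sum_(p in row_stab) aG p) *m (\sum_(q in col_stab) (-1) ^+ q *: aG q).

(* The Specht module is the right ideal of the group algebra generated by the
   Young symmetrizer; right ideals match the right-action convention of
   mxrepresentation. *)
Definition specht_mx : 'M[algC]_#|[set: 'S_n]%G| :=
  cyclic_mx aG (gring_row young_symmetrizer).

Definition specht_repr : mx_representation algC [set: 'S_n]%G (\rank specht_mx) :=
  submod_repr (cyclic_mx_module aG (gring_row young_symmetrizer)).

Definition specht_dim : nat := \rank specht_mx.

Definition specht_char : 'CF([set: 'S_n]) := cfRepr specht_repr.

Definition norm_char (s : 'S_n) : algC := specht_char s / specht_dim%:R.

End Specht.

(* Main.v *)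
(* Fix a representation V of S_n of degree d. A character of Sym K, K = supp s,
   decomposes as sum m_i chi_i, and |chi_i(s)| is at most the square root of the
   order of the centralizer of s in Sym K, so it suffices to bound the number
   sum m_i of irreducible constituents of the restriction of V to Sym K.

   (a) The Okounkov-Vershik analysis of joint eigenvectors of the Jucys-Murphy
   elements shows that an eigenvalue a forces nonzero vectors on which some Sym A
   with |A| > |a| acts trivially (if a >= 0) or by the sign (if a <= 0).
   (b) On the Specht module of la no Sym A with |A| > max(la_1, la'_1) has nonzero
   invariants or sign-invariants, so the Jucys-Murphy eigenvalues are at most
   c = max(la_1, la'_1) - 1 in absolute value. This bounds the ratio
   dim V^(Sym (A + y)) / dim V^(Sym A), hence the dimension of the isotypic part of
   V for a character of type trivial or sign of a Young subgroup.
   (c) On any nonzero Sym K-module the sum of the squares of the Jucys-Murphy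
   elements is at least |K|(|K|-1)/6, so by (a) it has invariants or sign-invariants
   under some Sym R with |R|^2 >= |K|/6. Splitting off R and iterating, each
   irreducible constituent meets one of few signed Young isotypic parts, whose
   dimensions are bounded by (b); altogether
   sum m_i <= d (144 (1/sqrt k + c/n))^k with k = |K|. *)
Require Import Defs.
From HB Require Import structures.
From mathcomp Require Import all_boot all_order all_algebra.
From mathcomp Require Import all_fingroup all_solvable all_field all_character.
From mathcomp Require Import zify ring.

Set Implicit Arguments.
Unset Strict Implicit.
Unset Printing Implicit Defensive.

Import Order.TTheory GRing.Theory Num.Theory.
Local Open Scope ring_scope.

(* all_solvable rebinds [Sym] to the symmetric group of the whole type. *)
Local Notation Sym := perm.Sym_group.

(** * Combinatorics of Jucys-Murphy weights *)

Definition swap_at (R : Type) (a : nat -> R) (j i : nat) : R :=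
  if i == j then a j.+1 else if i == j.+1 then a j else a i.

Section WeightCombinatorics.

(** [W] abstracts the set of joint eigenvalue sequences of the Jucys-Murphy elements, closed under
    the swaps that the Okounkov-Vershik analysis allows. *)
Variables (W : (nat -> int) -> Prop) (k : nat).

Hypothesis W_first : forall a, W a -> a 0%N = 0.
Hypothesis W_neq : forall a j, W a -> (j.+1 < k)%N -> a j <> a j.+1.
Hypothesis W_swap : forall a j, W a -> (j.+1 < k)%N ->
  a j.+1 <> a j + 1 -> a j.+1 <> a j - 1 -> W (swap_at a j).
Hypothesis W_braid : forall a j, W a -> (j.+2 < k)%N ->
  a j.+2 = a j -> a j.+1 = a j - 1 -> False.
Hypothesis W_bound : forall a j, W a -> (j < k)%N -> a j <= j%:Z.

(** Induction on [q - p]: an admissible swap moves either end inward. Once both inner neighbours are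
    forced to equal [a p - 1], either they are the same entry, which [W_braid] excludes, or
    induction between them produces a copy of [a p] nearer to [p], and induction applies again. *)
Lemma weight_repeat a p q : W a -> (p < q < k)%N -> a p = a q ->
  exists2 r, (p < r < q)%N & a r = a p + 1.
Proof.
have [m] := ubnP (q - p)%N; elim: m a p q => // m IH a p q ltqp Wa /andP[ltpq ltqk] apq.
have neq_p := W_neq Wa (leq_ltn_trans ltpq ltqk).
have q_gt0 : (0 < q)%N by lia.
have eq_q : q = q.-1.+1 by lia.
have neq_q : a q.-1 <> a q.-1.+1 by apply: W_neq; rewrite -?eq_q.
have ltpq1 : (p.+1 < q)%N.
  rewrite ltn_neqAle ltpq andbT; apply/eqP=> eqq; apply: neq_p; congruence.
have [/eqP ap1|/eqP ap1] := boolP (a p.+1 == a p + 1).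
  by exists p.+1; rewrite ?ap1 //; lia.
have [/eqP ap2|/eqP ap2] := boolP (a p.+1 == a p - 1); last first.
  have := IH _ p.+1 q _ (W_swap Wa (leq_ltn_trans ltpq ltqk) ap1 ap2).
  rewrite /swap_at => /(_ ltac:(lia) ltac:(lia)).
  have -> : (p.+1 == p) = false by lia.
  have -> : (q == p) = false by lia.
  have -> : (q == p.+1) = false by lia.
  rewrite eqxx => /(_ apq)[r ltr]; have -> : (r == p) = false by lia.
  have -> : (r == p.+1) = false by lia.
  by exists r => //; lia.
have [/eqP aq1|/eqP aq1] := boolP (a q.-1 == a q + 1).
  by exists q.-1; rewrite ?aq1 ?apq //; lia.
have [/eqP aq2|/eqP aq2] := boolP (a q.-1 == a q - 1); last first.
  have ltq1 : (q.-1.+1 < k)%N by lia.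
  have := IH _ p q.-1 _ (W_swap Wa ltq1 _ _).
  rewrite /swap_at -!eq_q eqxx => /(_ ltac:(lia)).
  have -> : (p == q.-1) = false by lia.
  have -> : (p == q) = false by lia.
  move=> /(_ ltac:(lia) ltac:(lia) ltac:(lia) apq)[r ltr].
  have -> : (r == q.-1) = false by lia.
  have -> : (r == q) = false by lia.
  by exists r => //; lia.
have [ltpq2|leqp2] := ltnP p.+1 q.-1; last first.
  have eqq : q = p.+2 by lia.
  by case: (@W_braid a p Wa); rewrite -?eqq.
have [|||r ltr ar] := IH a p.+1 q.-1 _ Wa; [lia | lia | lia |].
have [|||r' ltr' ar'] := IH a p r _ Wa; [lia | lia | lia |].
by exists r' => //; lia.
Qed.

(** The entry [y] differs by more than one from every member of the run [c - j, ..., c] that follows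
    it, so it can be swapped past the whole run, which moves [c] one place towards the front. *)
Lemma weight_shift j p a (y c : int) : W a -> (p + j.+1 < k)%N -> a p = y ->
  (forall l, (l <= j)%N -> a (p + l.+1)%N = c - j%:Z + l%:Z) ->
  y < c - j%:Z - 1 \/ c + 1 < y -> exists2 b, W b & b (p + j)%N = c.
Proof.
elim: j p a => [|j IH] p a Wa ltk ap chain hy.
  have a1 := chain 0%N isT; rewrite addn1 in a1 ltk.
  exists (swap_at a p); last by rewrite /swap_at addn0 eqxx a1; lia.
  by apply: W_swap => //; rewrite a1 ap; lia.
have a1 := chain 0%N isT; rewrite addn1 in a1.
have Wb : W (swap_at a p) by apply: W_swap => //; rewrite ?a1 ?ap; lia.
have [||||b Wb' bc] := IH p.+1 _ Wb _.
- lia.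
- by rewrite /swap_at eqxx; have -> : (p.+1 == p) = false by lia.
- move=> l lel; rewrite /swap_at.
  have -> : (p.+1 + l.+1 == p)%N = false by lia.
  have -> : (p.+1 + l.+1 == p.+1)%N = false by lia.
  by rewrite addSnnS chain; lia.
- lia.
by exists b; rewrite // -addSnnS.
Qed.

(** Outer induction on the room [k - c] above the value, inner induction on its position. Walking
    back from [c], an entry extends the descending run, or equals [c + 1] (outer induction), or
    repeats a value of the run (impossible), or can be shifted past the run (inner induction). A run
    that reaches position 0 is a staircase because [a 0 = 0]. *)
Lemma weight_staircase (c : int) i a : W a -> (i < k)%N -> a i = c ->
  exists b t, [/\ W b, (t < k)%N, c <= t%:Z & forall j, (j <= t)%N -> b j = j%:Z].
Proof.
have [N] : exists N : nat, k%:Z <= c + N%:Z by exists (k + `|c|)%N; lia.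
elim: N c i a => [|N IHN] c i a leN Wa ltik aic.
  by have := W_bound Wa ltik; lia.
have [m] := ubnP i; elim: m i a Wa ltik aic => // m IHm i a Wa ltik aic ltim.
have chain j : (j <= i)%N ->
    (exists b t, [/\ W b, (t < k)%N, c <= t%:Z
       & forall l, (l <= t)%N -> b l = l%:Z])
    \/ (forall l, (l <= j)%N -> a (i - l)%N = c - l%:Z).
  elim: j => [|j IHj] leji.
    by right=> l; rewrite leqn0 => /eqP->; rewrite subn0 aic; lia.
  have [|done|ch] := IHj; [lia | by left | ].
  have [/eqP y1|/eqP y1] := boolP (a (i - j.+1)%N == c - j.+1%:Z).
    right=> l; rewrite leq_eqVlt => /orP[/eqP->|]; first by [].
    by apply: ch.
  left; have [y2|y2] := boolP (a (i - j.+1)%N == c + 1).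
    have [|||b [t [Wb tk cle bt]]] := IHN (c + 1) (i - j.+1)%N a _ Wa.
    - lia.
    - lia.
    - exact/eqP.
    by exists b, t; split => //; lia.
  have [inch|outch] := boolP (c - j%:Z <= a (i - j.+1)%N <= c).
    pose l := `|c - a (i - j.+1)%N|%N.
    have lel : (l <= j)%N by rewrite /l; lia.
    have al := ch l lel.
    have [||r rb ra] := @weight_repeat a (i - j.+1) (i - l) Wa.
    - lia.
    - by rewrite al /l; lia.
    (* Entries of the run to the left of position [i - l] are smaller than the repeated value,
       whereas [weight_repeat] provides a larger one. *)
    have := ch (i - r)%N; have -> : (i - (i - r) = r)%N by lia.
    by move=> /(_ ltac:(lia)); rewrite ra /l in al rb *; lia.
  have [||||b Wb bc] := @weight_shift j (i - j.+1) a (a (i - j.+1)%N) c Wa.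
  - lia.
  - by [].
  - move=> l lel; have -> : (i - j.+1 + l.+1 = i - (j - l))%N by lia.
    by rewrite ch; lia.
  - lia.
  by apply: (IHm (i - j.+1 + j)%N b Wb) => //; lia.
have [//|] := chain i (leqnn i).
move=> ch; have := ch i (leqnn i); rewrite subnn W_first // => ci.
exists a, i; split => //; first lia.
by move=> j leji; have := ch (i - j)%N; rewrite subKn // => -> //; lia.
Qed.

End WeightCombinatorics.

(** * Signed sums over symmetric groups *)

Section Perms.
Variable T : finType.
Implicit Types (A B : {set T}) (g h : {perm T}).

Lemma in_Sym A g : (g \in Sym A) = perm_on A g.
Proof. by rewrite inE. Qed.

Lemma Sym_out A g x : g \in Sym A -> x \notin A -> g x = x.
Proof. by rewrite in_Sym; apply: out_perm. Qed.

Lemma SymS A B : A \subset B -> Sym A \subset Sym B.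
Proof.
move=> sAB; apply/subsetP=> g; rewrite !in_Sym => /subsetP gA.
by apply/subsetP=> x /gA; apply: (subsetP sAB).
Qed.

Lemma Sym_mem A g x : g \in Sym A -> (g x \in A) = (x \in A).
Proof. by rewrite in_Sym => gA; rewrite perm_closed. Qed.

Lemma tperm_Sym A x y : x \in A -> y \in A -> tperm x y \in Sym A.
Proof.
move=> xA yA; rewrite in_Sym; apply/subsetP=> z; rewrite inE.
by case: tpermP => [->|->|_ _ /eqP].
Qed.

Lemma Sym_imset_fix A B g : g \in Sym A -> A \subset B -> g @: B = B.
Proof.
move=> gA sAB; have gB := subsetP (SymS sAB) g gA.
apply/eqP; rewrite eqEcard card_imset ?leqnn ?andbT; last exact: perm_inj.
by apply/subsetP=> _ /imsetP[x xB ->]; rewrite Sym_mem.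
Qed.

Lemma Sym_imset_disjoint A B g : g \in Sym A -> [disjoint A & B] -> g @: B = B.
Proof.
move=> gA dAB; rewrite -[RHS]imset_id; apply: eq_in_imset => x xB.
by rewrite (Sym_out gA) // (disjointFl dAB).
Qed.

Lemma Sym_conj A g h : (h ^ g \in Sym (g @: A))%g = (h \in Sym A).
Proof.
rewrite !in_Sym; apply/subsetP/subsetP=> hA x; rewrite inE => hx.
  have := hA (g x); rewrite inE permJ (inj_eq perm_inj) => /(_ hx).
  by rewrite mem_imset //; apply: perm_inj.
rewrite -[x](permKV g) mem_imset; last exact: perm_inj.
apply: hA; rewrite inE; apply: contra hx => /eqP hx.
by rewrite -[x](permKV g) permJ hx.
Qed.

Lemma odd_permJ g h : odd_perm (h ^ g)%g = odd_perm h.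
Proof.
by rewrite /conjg !odd_permM odd_permV addbCA addbb addbF.
Qed.

End Perms.

Definition sg (T : finType) (eps : bool) (h : {perm T}) : algC :=
  (-1) ^+ (eps && odd_perm h).

Section SignedSums.
Variable T : finType.

Lemma sgM eps (g h : {perm T}) : sg eps (g * h) = sg eps g * sg eps h.
Proof. by rewrite /sg odd_permM andb_addr signr_addb. Qed.

Lemma sg1 eps : sg eps (1 : {perm T}) = 1.
Proof. by rewrite /sg odd_perm1 andbF. Qed.

Lemma sg_sqr eps (g : {perm T}) : sg eps g * sg eps g = 1.
Proof. by rewrite /sg -signr_addb addbb. Qed.

Lemma sgJ eps (g h : {perm T}) : sg eps (h ^ g) = sg eps h.
Proof. by rewrite /sg odd_permJ. Qed.

Lemma sg_tperm eps (x y : T) : x != y -> sg eps (tperm x y) = (-1) ^+ eps.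
Proof. by move=> neq; rewrite /sg odd_tperm neq andbT. Qed.

(** Up to the factor [#|A|!], this is the projector onto the trivial ([eps = false]) or sign
    ([eps = true]) isotypic part for [Sym A]. *)
Definition sym_sum d (f : {perm T} -> 'M[algC]_d) eps (A : {set T}) : 'M_d :=
  \sum_(h in Sym A) sg eps h *: f h.

(** Jucys-Murphy elements are the stars for which [I] consists of the points preceding [y]. *)
Definition star_sum d (f : {perm T} -> 'M[algC]_d) (y : T) (I : {set T}) : 'M_d :=
  \sum_(z in I) f (tperm z y).

Variables (K0 : {set T}) (d : nat) (rG : mx_representation algC (Sym K0) d).
Implicit Types (A I : {set T}) (g h : {perm T}).

Local Notation symS := (sym_sum rG).
Local Notation star := (star_sum rG).

Lemma sub_Sym A h : A \subset K0 -> h \in Sym A -> h \in Sym K0.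
Proof. by move/SymS/subsetP; apply. Qed.

Lemma sym_sum_mulr eps A h : A \subset K0 -> h \in Sym A ->
  symS eps A *m rG h = sg eps h *: symS eps A.
Proof.
move=> sA hA; rewrite mulmx_suml scaler_sumr.
rewrite [RHS](reindex_inj (mulIg h)) /=.
apply: eq_big => g; first by rewrite groupMr.
move=> gA; rewrite -scalemxAl -repr_mxM ?(sub_Sym sA) // scalerA sgM.
by rewrite mulrC -mulrA sg_sqr mulr1.
Qed.

Lemma sym_sum_mull eps A h : A \subset K0 -> h \in Sym A ->
  rG h *m symS eps A = sg eps h *: symS eps A.
Proof.
move=> sA hA; rewrite mulmx_sumr scaler_sumr.
rewrite [RHS](reindex_inj (mulgI h)) /=.
apply: eq_big => g; first by rewrite groupMl.
move=> gA; rewrite -scalemxAr -repr_mxM ?(sub_Sym sA) // scalerA sgM.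
by rewrite mulrA sg_sqr mul1r.
Qed.

Lemma sym_sum_sqr eps A : A \subset K0 ->
  symS eps A *m symS eps A = #|A|`!%:R *: symS eps A.
Proof.
move=> sA; rewrite {2}/sym_sum mulmx_sumr.
rewrite (eq_bigr (fun=> symS eps A)) => [|h hA]; last first.
  by rewrite -scalemxAr sym_sum_mulr // scalerA sg_sqr scale1r.
by rewrite sumr_const perm.card_Sym scaler_nat.
Qed.

Lemma sym_sumJ eps A g : A \subset K0 -> g \in Sym K0 ->
  symS eps A *m rG g = rG g *m symS eps (g @: A).
Proof.
move=> sA gK; rewrite mulmx_suml mulmx_sumr.
rewrite [RHS](reindex_inj (conjg_inj g)) /=.
apply: eq_big => h; first by rewrite Sym_conj.
move=> hA; have hK := sub_Sym sA hA.
rewrite sgJ -scalemxAl -scalemxAr -!repr_mxM ?groupJ //.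
by rewrite conjgC.
Qed.

Lemma starJ y I g : y \in K0 -> I \subset K0 -> g \in Sym K0 ->
  star y I *m rG g = rG g *m star (g y) (g @: I).
Proof.
move=> yK sI gK; rewrite /star_sum mulmx_suml mulmx_sumr big_imset /=; last first.
  by move=> ? ? _ _; apply: perm_inj.
apply: eq_bigr => z zI; have zK := subsetP sI z zI.
have tK := tperm_Sym zK yK.
by rewrite -tpermJ -!repr_mxM ?groupJ // conjgC.
Qed.

Lemma starU1 y z I : z \notin I -> star y (z |: I) = rG (tperm z y) + star y I.
Proof. by move=> zI; rewrite /star_sum big_setU1. Qed.

(** Each [h] in [Sym (y |: A)] factors uniquely as an element of [Sym A] times [tperm (h y) y].
    Iterated, this writes a symmetrizer as a product of factors [1 + X] with [X] a Jucys-Murphy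
    element, up to signs. *)
Lemma sym_sumU1 eps y A : y \notin A -> y |: A \subset K0 ->
  symS eps (y |: A) = symS eps A *m (1%:M + (-1) ^+ eps *: star y A).
Proof.
move=> yA sA; have sA' : A \subset K0 by apply: subset_trans sA; apply: subsetUr.
have yK : y \in K0 by rewrite (subsetP sA) ?setU11.
transitivity (\sum_(z in y |: A) sg eps (tperm z y) *: (symS eps A *m rG (tperm z y))).
  rewrite /sym_sum (partition_big (fun h => h y) (mem (y |: A))) /=; last first.
    by move=> h hA; rewrite Sym_mem ?setU11.
  apply: eq_bigr => z zA; rewrite mulmx_suml scaler_sumr.
  rewrite (reindex_inj (mulIg (tperm z y))) /=.
  have tA : tperm z y \in Sym (y |: A) by rewrite tperm_Sym ?setU11.
  apply: eq_big => h.
    rewrite groupMr //; apply/andP/idP=> [[hA /eqP]|hA].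
      rewrite permM => /(canRL (tpermK z y)); rewrite tpermL => hy.
      rewrite in_Sym; apply/subsetP=> x; rewrite inE => hx.
      have : x \in y |: A by apply: contraNT hx => xA; rewrite (Sym_out hA xA).
      by rewrite !inE; case: eqP => // xy; rewrite xy hy eqxx in hx.
    split; first exact: (subsetP (SymS (subsetUr _ _))).
    by rewrite permM (Sym_out hA yA) tpermR.
  move=> /andP[hA _].
  have hA' : h \in Sym (y |: A) by rewrite -[h](mulgK (tperm z y)) groupM ?groupV.
  rewrite sgM mulrC -scalerA -scalemxAl -repr_mxM //; apply: sub_Sym sA _ => //.
rewrite big_setU1 //= tperm1 sg1 scale1r repr_mx1 mulmx1 mulmxDr mulmx1.
congr (_ + _); rewrite -scalemxAr mulmx_sumr scaler_sumr; apply: eq_bigr => z zA.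
rewrite sg_tperm //; by apply: contraNneq yA => <-.
Qed.

End SignedSums.

(** * Jucys-Murphy elements *)

Lemma common_eigenvector_in d (V : 'M[algC]_d) (As : seq 'M[algC]_d) :
    V != 0 -> {in As &, forall A B, comm_mx A B} ->
    {in As, forall A, stablemx V A} ->
  exists v : 'rV_d, [/\ v != 0, (v <= V)%MS &
    {in As, forall A, exists a, v *m A = a *: v}].
Proof.
move=> V0 cA sA.
have [||v v0 /allP vP] := common_eigenvector (n := \rank V) (As := [seq restrictmx V A | A <- As]).
- by rewrite lt0n mxrank_eq0.
- move=> _ _ /mapP[A AA ->] /mapP[B BA ->]; rewrite /comm_mx.
  by rewrite -!conjmxM ?inE ?stablemx_row_base ?sA // (cA A B).
exists (v *m row_base V); split.
- by rewrite mulmx_free_eq0 ?row_base_free.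
- by rewrite mulmx_sub // eq_row_base.
move=> A AA; have := vP _ (map_f (fun A => restrictmx V A) AA).
by rewrite stablemx_restrict ?sA // => /sub_rVP[a ->]; exists a.
Qed.

(** * Invariant Hermitian form *)

Section InvariantForm.
Variables (gT : finGroupType) (G : {group gT}) (d : nat).
Variable rG : mx_representation algC G d.
Implicit Types u v : 'rV[algC]_d.

Definition dotv u v : algC := \sum_j u 0 j * (v 0 j)^*.

(** Averaging over [G] makes the action unitary, so involutions of [G], in particular
    transpositions, are self-adjoint. *)
Definition hform u v : algC := \sum_(g in G) dotv (u *m rG g) (v *m rG g).

Lemma hformDl u1 u2 v : hform (u1 + u2) v = hform u1 v + hform u2 v.
Proof.
rewrite -big_split; apply: eq_bigr => g _; rewrite -big_split; apply: eq_bigr => j _.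
by rewrite mulmxDl mxE mulrDl.
Qed.

Lemma hformZl a u v : hform (a *: u) v = a * hform u v.
Proof.
rewrite mulr_sumr; apply: eq_bigr => g _; rewrite mulr_sumr; apply: eq_bigr => j _.
by rewrite -scalemxAl mxE mulrA.
Qed.

Lemma hformC u v : hform v u = (hform u v)^*.
Proof.
rewrite rmorph_sum; apply: eq_bigr => g _; rewrite rmorph_sum; apply: eq_bigr => j _.
by rewrite rmorphM /= conjCK mulrC.
Qed.

Lemma hformZr a u v : hform u (a *: v) = a^* * hform u v.
Proof. by rewrite hformC hformZl rmorphM /= -hformC. Qed.

Lemma hformDr u v1 v2 : hform u (v1 + v2) = hform u v1 + hform u v2.
Proof. by rewrite hformC hformDl rmorphD /= -!hformC. Qed.

Lemma hform0l v : hform 0 v = 0.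
Proof. by rewrite -(scale0r (0 : 'rV_d)) hformZl mul0r. Qed.

Lemma hform0r v : hform v 0 = 0.
Proof. by rewrite hformC hform0l rmorph0. Qed.

Lemma hform_suml I r (P : pred I) (F : I -> 'rV_d) v :
  hform (\sum_(i <- r | P i) F i) v = \sum_(i <- r | P i) hform (F i) v.
Proof. by apply: (big_morph (hform^~ v)) => [u1 u2|]; rewrite ?hformDl ?hform0l. Qed.

Lemma hform_sumr I r (P : pred I) (F : I -> 'rV_d) v :
  hform v (\sum_(i <- r | P i) F i) = \sum_(i <- r | P i) hform v (F i).
Proof. by apply: (big_morph (hform v)) => [u1 u2|]; rewrite ?hformDr ?hform0r. Qed.

Lemma hform_ge0 v : 0 <= hform v v.
Proof. by do 2!apply: sumr_ge0 => ? _; apply: mul_conjC_ge0. Qed.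

Lemma hform_gt0 v : v != 0 -> 0 < hform v v.
Proof.
move=> v0; have [j vj] : exists j, v 0 j != 0.
  by apply/existsP; apply: contra_neqT v0 => /existsPn v0; apply/rowP=> j;
     rewrite mxE; apply/eqP; have := v0 j; rewrite negbK.
rewrite /hform (bigD1 1%g) //= ltr_pwDl //; last first.
  by do 2!apply: sumr_ge0 => ? _; apply: mul_conjC_ge0.
rewrite repr_mx1 mulmx1 /dotv (bigD1 j) //= ltr_pwDl ?mul_conjC_gt0 //.
by apply: sumr_ge0 => ? _; apply: mul_conjC_ge0.
Qed.

Lemma hform_invariant u v h : h \in G -> hform (u *m rG h) (v *m rG h) = hform u v.
Proof.
move=> hG; rewrite /hform [RHS](reindex_inj (mulgI h)) /=.
apply: eq_big => g; first by rewrite groupMl.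
by move=> gG; rewrite repr_mxM // !mulmxA.
Qed.

Lemma hform_involution u v h : h \in G -> (h * h = 1)%g ->
  hform (u *m rG h) v = hform u (v *m rG h).
Proof.
move=> hG hh; rewrite -(hform_invariant _ _ hG) -!mulmxA -!repr_mxM //.
by rewrite hh repr_mx1 mulmx1.
Qed.

End InvariantForm.

Section JucysMurphy.
Variables (T : finType) (K0 : {set T}) (d : nat).
Variable rG : mx_representation algC (Sym K0) d.
Variable P : 'M[algC]_d.
Variables (k : nat) (x : nat -> T).
Hypothesis x_inj : {in gtn k &, injective x}.
Hypothesis xK : forall i, (i < k)%N -> x i \in K0.
Hypothesis P_comm : forall i j, (i < k)%N -> (j < k)%N ->
  comm_mx P (rG (tperm (x i) (x j))).

Local Notation star := (star_sum rG).

Definition initial j : {set T} := [set x (val i) | i : 'I_j].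
Definition jm j := star (x j) (initial j).

Local Notation L := initial.
Local Notation X := jm.

Lemma initialP y j : reflect (exists2 i, (i < j)%N & y = x i) (y \in L j).
Proof.
apply: (iffP imsetP) => [[i _ ->]|[i ltij ->]]; first by exists i.
by exists (Ordinal ltij).
Qed.

Lemma initialS j : L j.+1 = x j |: L j.
Proof.
apply/setP=> y; rewrite !inE; apply/initialP/orP.
  case=> i; rewrite ltnS leq_eqVlt => /orP[/eqP-> ->|ltij ->]; first by left.
  by right; apply/initialP; exists i.
by case=> [/eqP->|/initialP[i ltij ->]]; [exists j | exists i; rewrite // ltnW].
Qed.

Lemma initial0 : L 0 = set0.
Proof. by apply/setP=> y; rewrite inE; apply/initialP=> -[]. Qed.

Lemma x_initial i j : (i < k)%N -> (j <= k)%N -> (x i \in L j) = (i < j)%N.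
Proof.
move=> ltik lejk; apply/initialP/idP => [[l ltlj xl]|ltij]; last by exists i.
by rewrite (x_inj _ _ xl) // inE /= ?(leq_trans ltlj).
Qed.

Lemma initial_sub j : (j <= k)%N -> L j \subset K0.
Proof.
by move=> lejk; apply/subsetP=> _ /initialP[i ltij ->]; rewrite xK ?(leq_trans ltij).
Qed.

Lemma card_initial j : (j <= k)%N -> #|L j| = j.
Proof.
elim: j => [|j IH] ltjk; first by rewrite initial0 cards0.
by rewrite initialS cardsU1 x_initial ?ltnn ?IH // ltnW.
Qed.

Lemma tpermK0 i j : (i < k)%N -> (j < k)%N -> tperm (x i) (x j) \in Sym K0.
Proof. by move=> ik jk; rewrite tperm_Sym ?xK. Qed.

Lemma P_comm_jm j : (j < k)%N -> comm_mx P (X j).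
Proof.
move=> ltjk; apply: comm_mx_sum => _ /initialP[i ltij ->].
by apply: P_comm; rewrite // (ltn_trans ltij).
Qed.

Lemma jm_comm_perm g j : (j < k)%N -> g \in Sym K0 -> g (x j) = x j ->
  g @: L j = L j -> X j *m rG g = rG g *m X j.
Proof.
move=> ltjk gK gx gL; rewrite starJ ?xK ?initial_sub ?gx ?gL //; exact: ltnW.
Qed.

Lemma jm_comm i j : (i < k)%N -> (j < k)%N -> X i *m X j = X j *m X i.
Proof.
wlog ltij : i j / (i < j)%N => [hw|] ik jk.
  by case: (ltngtP i j) => [lt|lt|->] //; [apply: hw | rewrite (hw j i)].
rewrite mulmx_suml mulmx_sumr; apply: eq_bigr => _ /initialP[l ltli ->].
have ltlj := ltn_trans ltli ltij.
rewrite jm_comm_perm ?tpermK0 ?(ltn_trans ltlj) //.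
  by rewrite tpermD // (inj_in_eq x_inj) ?inE /= ?(ltn_trans ltlj) // neq_ltn ?ltij ?ltlj.
apply: (@Sym_imset_fix _ (L j)) => //.
have lejk := ltnW jk; have ltlk := ltn_trans ltlj jk.
by rewrite tperm_Sym ?x_initial.
Qed.

Definition adj j := rG (tperm (x j) (x j.+1)).
Local Notation s := adj.

Lemma adj_sqr j : (j.+1 < k)%N -> s j *m s j = 1%:M.
Proof.
move=> jk; rewrite -repr_mxM ?tpermK0 // ?(ltnW jk) //.
by rewrite tperm2 repr_mx1.
Qed.

(** This is a degenerate affine Hecke relation: conjugation by [s j] turns the star [X j] into
    [X j.+1] without its transposition [s j], and that missing term contributes [s j *m s j], the
    identity. *)
Lemma jm_adj_lt j : (j.+1 < k)%N -> X j *m s j + 1%:M = s j *m X j.+1.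
Proof.
move=> jk; have jk' := ltnW jk.
rewrite /jm initialS starU1 ?x_initial ?ltnn ?(ltnW jk') //.
rewrite mulmxDr -/(adj j) adj_sqr // addrC; congr (_ + _).
rewrite starJ ?tpermK0 ?xK ?initial_sub ?(ltnW jk') // tpermL.
rewrite (@Sym_imset_disjoint _ [set x j; x j.+1]) //.
  by rewrite tperm_Sym ?set21 ?set22.
rewrite -setI_eq0; apply/eqP/setP=> y; rewrite !inE.
apply/negP=> /andP[/orP[]/eqP->]; rewrite x_initial // ?ltnn ?(ltnW jk') //.
by rewrite ltnNge leqnSn.
Qed.

Lemma jm_adj_gt j : (j.+1 < k)%N -> X j.+1 *m s j = s j *m X j + 1%:M.
Proof.
move=> jk; rewrite -[X j.+1]mul1mx -(adj_sqr jk) -[_ *m _ *m X _]mulmxA -jm_adj_lt //.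
rewrite mulmxDr mulmx1 mulmxDl adj_sqr // -mulmxA -mulmxA adj_sqr //.
by rewrite mulmx1.
Qed.

Lemma jm_adj_comm i j : (i < k)%N -> (j.+1 < k)%N -> i != j -> i != j.+1 ->
  X i *m s j = s j *m X i.
Proof.
move=> ik jk neq1 neq2; have jk' := ltnW jk; rewrite /adj jm_comm_perm ?tpermK0 //.
  by rewrite tpermD // (inj_in_eq x_inj) ?inE //= eq_sym.
have [ltij|leji] := ltnP i j; last first.
  apply: (@Sym_imset_fix _ (L i)) => //.
  by rewrite tperm_Sym // x_initial ?(ltnW ik) //; lia.
apply: (@Sym_imset_disjoint _ [set x j; x j.+1]).
  by rewrite tperm_Sym ?set21 ?set22.
rewrite -setI_eq0; apply/eqP/setP=> y; rewrite !inE.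
apply/negP=> /andP[/orP[]/eqP->]; rewrite x_initial // ?(ltnW ik) //; lia.
Qed.

Lemma adj_braid j : (j.+2 < k)%N -> s j *m s j.+1 *m s j = s j.+1 *m s j *m s j.+1.
Proof.
move=> jk; have jk1 := ltnW jk; have jk2 := ltnW jk1.
rewrite -!repr_mxM ?groupM ?tpermK0 //; congr (rG _).
have neq a b : [&& a != b, a <= j.+2 & b <= j.+2]%N -> (x a == x b) = false.
  by move=> /and3P[neab lea leb]; rewrite (inj_in_eq x_inj) ?inE /=; lia.
have e1 : (tperm (x j) (x j.+1) * tperm (x j.+1) (x j.+2) * tperm (x j) (x j.+1)
   = tperm (x j.+1) (x j.+2) ^ tperm (x j) (x j.+1))%g.
  by rewrite /conjg tpermV mulgA.
have e2 : (tperm (x j.+1) (x j.+2) * tperm (x j) (x j.+1) * tperm (x j.+1) (x j.+2)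
   = tperm (x j) (x j.+1) ^ tperm (x j.+1) (x j.+2))%g.
  by rewrite /conjg tpermV mulgA.
by rewrite e1 e2 !tpermJ tpermR tpermL !tpermD ?neq //; lia.
Qed.

(** The condition [v *m P = v] confines the eigenvectors to the row space of [P], which will be the
    product of the projections for the blocks already split off. *)
Definition joint_eigen (a : nat -> algC) (v : 'rV[algC]_d) :=
  [/\ v != 0, v *m P = v & forall j, (j < k)%N -> v *m X j = a j *: v].

Definition weight a := exists v, joint_eigen a v.

Lemma hform_star (u v : 'rV[algC]_d) y (I : {set T}) : y \in K0 -> I \subset K0 ->
  hform rG (u *m star y I) v = hform rG u (v *m star y I).
Proof.
move=> yK sI; rewrite !mulmx_sumr hform_suml hform_sumr; apply: eq_bigr => z zI.
by rewrite hform_involution ?tperm2 // tperm_Sym // (subsetP sI).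
Qed.

Lemma hform_jm (u v : 'rV[algC]_d) j : (j < k)%N -> hform rG (u *m X j) v = hform rG u (v *m X j).
Proof. by move=> jk; rewrite hform_star ?xK ?initial_sub // ltnW. Qed.

Lemma weight_real a j : weight a -> (j < k)%N -> (a j)^* = a j.
Proof.
move=> [v [v0 _ va]] jk; apply: (mulIf (lt0r_neq0 (hform_gt0 rG v0))).
by rewrite -hformZr -hformZl -va // hform_jm.
Qed.

Lemma weight_first a : weight a -> (0 < k)%N -> a 0%N = 0.
Proof.
move=> [v [v0 _ va]] k0; have := va _ k0; rewrite /jm initial0 /star_sum big_set0 mulmx0.
by move/esym/eqP; rewrite scaler_eq0 (negPf v0) orbF => /eqP.
Qed.

(* Equal adjacent weights would give [jm j.+1] a Jordan block, contradicting its
   self-adjointness for [hform]. *)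
Lemma weight_neq a j : weight a -> (j.+1 < k)%N -> a j <> a j.+1.
Proof.
move=> wa jk eqa; have aR := weight_real wa jk; have jk' := ltnW jk.
have [v [v0 _ va]] := wa.
have e : v = v *m s j *m X j.+1 - a j.+1 *: (v *m s j).
  rewrite -mulmxA -jm_adj_lt // mulmxDr mulmx1 mulmxA va // -scalemxAl eqa.
  by rewrite addrAC subrr add0r.
have /eqP[] := lt0r_neq0 (hform_gt0 rG v0).
rewrite {1}e -scaleN1r hformDl !hformZl hform_jm // va // hformZr aR.
by rewrite mulN1r subrr.
Qed.

(** The Hecke relations show that the intertwiner image [(a j.+1 - a j) *: (v *m s j) - v] has the
    eigenvalues at [j] and [j.+1] exchanged; the hypothesis says that it is nonzero. *)
Lemma weight_swap_vec a j v : joint_eigen a v -> (j.+1 < k)%N ->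
  (a j.+1 - a j) *: (v *m s j) != v -> weight (swap_at a j).
Proof.
move=> [v0 vP va] jk wn0; have jk' := ltnW jk.
exists ((a j.+1 - a j) *: (v *m s j) - v); split; first by rewrite subr_eq0.
  rewrite mulmxBl vP -scalemxAl -mulmxA -[_ *m P]P_comm //.
  by rewrite mulmxA vP.
move=> i ik; rewrite /swap_at mulmxBl -scalemxAl va // -mulmxA.
case: eqP => [->|/eqP neq1].
  have -> : s j *m X j = X j.+1 *m s j - 1%:M by rewrite jm_adj_gt // addrK.
  rewrite mulmxBr mulmxA va // mulmx1 -scalemxAl scalerBr scalerBr !scalerA.
  rewrite -addrA; congr (_ + _); first by rewrite mulrC.
  by rewrite -opprD -scalerDl subrK.
case: eqP => [->|/eqP neq2].
  rewrite -jm_adj_lt // mulmxDr mulmx1 mulmxA va // -scalemxAl scalerDr !scalerA.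
  rewrite -addrA scalerBr scalerA; congr (_ + _); first by rewrite mulrC.
  by rewrite -scalerBl addrAC subrr add0r scaleNr.
rewrite -jm_adj_comm // mulmxA va // -scalemxAl scalerBr !scalerA.
by rewrite mulrC.
Qed.

(** If the intertwiner kills [v], then [v] is an eigenvector of the involution [s j] with eigenvalue
    [c = a j.+1 - a j], whence [c ^+ 2 = 1]. *)
Lemma weight_swap a j : weight a -> (j.+1 < k)%N ->
  a j.+1 <> a j + 1 -> a j.+1 <> a j - 1 -> weight (swap_at a j).
Proof.
move=> [v av] jk ne1 ne2; apply: (weight_swap_vec av jk); apply/eqP=> e.
have [v0 _ _] := av; set c := a j.+1 - a j in e.
have e' : v *m s j = c *: v by rewrite -{1}e -scalemxAl -mulmxA adj_sqr // mulmx1.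
have : (c ^+ 2 - 1) *: v = 0.
  by rewrite scalerBl scale1r -{2}e e' scalerA subrr.
move/eqP; rewrite scaler_eq0 (negPf v0) orbF subr_eq0 sqrf_eq1 /c.
by case/orP=> /eqP e3; [apply: ne1 | apply: ne2]; rewrite -e3 addrC subrK.
Qed.

(** A nonzero intertwiner image at [j] or [j.+1] would have two equal adjacent weights. So both
    vanish, which forces [s j] to act on [v] by [-1] and [s j.+1] by [1]; the two sides of the braid
    relation then act with opposite signs. *)
Lemma weight_braid a j : weight a -> (j.+2 < k)%N ->
  a j.+2 = a j -> a j.+1 = a j - 1 -> False.
Proof.
move=> [v av] jk e2 e1; have jk1 := ltnW jk; have [v0 _ _] := av.
have s1 : v *m s j = - v.
  have [/eqP e3|ne] := boolP ((a j.+1 - a j) *: (v *m s j) == v).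
    by rewrite -[in RHS]e3 e1 addrAC subrr add0r scaleN1r opprK.
  have := @weight_neq _ j.+1 (weight_swap_vec av jk1 ne) jk.
  rewrite /swap_at eqxx.
  have -> : (j.+1 == j) = false by lia.
  have -> : (j.+2 == j) = false by lia.
  have -> : (j.+2 == j.+1) = false by lia.
  by rewrite e2; case.
have s2 : v *m s j.+1 = v.
  have [/eqP e3|ne] := boolP ((a j.+2 - a j.+1) *: (v *m s j.+1) == v).
    by rewrite -[RHS]e3 e2 e1 opprB addrC subrK scale1r.
  have := @weight_neq _ j (weight_swap_vec av jk ne) jk1.
  rewrite /swap_at eqxx.
  have -> : (j == j.+1) = false by lia.
  have -> : (j == j.+2) = false by lia.
  by rewrite e2; case.
have := congr1 (mulmx v) (adj_braid jk).
rewrite !mulmxA s1 s2 !mulNmx s2 s1 mulNmx s2 opprK.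
move/eqP; rewrite -addr_eq0 -mulr2n -scaler_nat scaler_eq0 pnatr_eq0 /=.
by rewrite (negPf v0).
Qed.

(** Either [a j.+1] differs by one from [a j], or swapping brings it to position [j], where
    induction applies. *)
Lemma weight_int a j : weight a -> (j < k)%N ->
  exists2 z : int, a j = z%:~R & `|z| <= j%:Z.
Proof.
elim: j a => [|j IH] a wa jk; first by exists 0; rewrite ?weight_first.
have [z az lez] := IH a wa (ltnW jk).
have [/eqP e1|/eqP e1] := boolP (a j.+1 == a j + 1).
  by exists (z + 1); rewrite ?e1 ?az ?rmorphD //=; lia.
have [/eqP e2|/eqP e2] := boolP (a j.+1 == a j - 1).
  by exists (z - 1); rewrite ?e2 ?az ?rmorphB //=; lia.
have [y] := IH _ (weight_swap wa jk e1 e2) (ltnW jk).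
by rewrite /swap_at eqxx => ay ley; exists y => //; lia.
Qed.

Lemma eq_weight a b : (forall j, (j < k)%N -> a j = b j) -> weight a -> weight b.
Proof. by move=> eqab [v [v0 vP va]]; exists v; split=> // j jk; rewrite -eqab ?va. Qed.

Lemma weight_invariants_pos a i : weight a -> (i < k)%N ->
  exists t, [/\ (t < k)%N, a i <= t%:R & P *m sym_sum rG false (L t.+1) != 0].
Proof.
move=> wa ik; pose W (z : nat -> int) := weight (fun j => (z j)%:~R).
pose z j := Num.floor (a j).
have az j : (j < k)%N -> a j = (z j)%:~R.
  by move=> jk; have [y ay _] := weight_int wa jk; rewrite /z ay intrKfloor.
have Wz : W z by apply: eq_weight wa.
have intI : injective (fun z : int => z%:~R : algC) by apply: intr_inj.
have W0 b : W b -> b 0%N = 0.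
  move=> wb; apply: intI; exact: weight_first wb (leq_ltn_trans _ ik).
have W1 b j : W b -> (j.+1 < k)%N -> b j <> b j.+1.
  by move=> wb jk eqb; apply: (weight_neq wb jk); rewrite eqb.
have W2 b j : W b -> (j.+1 < k)%N ->
    b j.+1 <> b j + 1 -> b j.+1 <> b j - 1 -> W (swap_at b j).
  move=> wb jk n1 n2; have := weight_swap wb jk.
  have -> : ((b j)%:~R + 1 : algC) = (b j + 1)%:~R by rewrite rmorphD.
  have -> : ((b j)%:~R - 1 : algC) = (b j - 1)%:~R by rewrite rmorphB.
  move=> /(_ (fun e => n1 (intI _ _ e)) (fun e => n2 (intI _ _ e))).
  by apply: eq_weight => l _; rewrite /swap_at; case: ifP => //; case: ifP.
have W3 b j : W b -> (j.+2 < k)%N -> b j.+2 = b j -> b j.+1 = b j - 1 -> False.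
  move=> wb jk e2 e1; apply: (weight_braid wb jk); first by rewrite e2.
  by rewrite e1 rmorphB.
have Wb b j : W b -> (j < k)%N -> b j <= j%:Z.
  move=> wb jk; have [y /intI ->] := weight_int wb jk; lia.
have [b [t [[v [v0 vP vb]] tk zt bt]]] := weight_staircase W0 W1 W2 W3 Wb Wz ik erefl.
exists t; split=> //; first by rewrite az // pmulrn ler_int.
(* On the staircase weight the factor [1 + jm j] acts by [j + 1], so the symmetrizers multiply [v]
   by factorials and cannot vanish. *)
have vS j : (j <= t.+1)%N -> v *m sym_sum rG false (L j) = (j`!)%:R *: v.
  elim: j => [|j IH] jt.
    have L0 : L 0 \subset K0 by rewrite initial0 sub0set.
    rewrite /sym_sum (big_pred1 1%g) => [|g /=]; last first.
      rewrite in_Sym initial0; apply/idP/eqP=> [|->]; last exact: perm_on1.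
      by move=> g0; apply/permP=> y; rewrite perm1 (out_perm g0) ?inE.
    by rewrite sg1 repr_mx1 scale1r mulmx1 scale1r.
  have jk : (j < k)%N by apply: leq_trans tk.
  rewrite initialS sym_sumU1 ?x_initial ?ltnn ?(ltnW jk) // -?initialS ?initial_sub //.
  rewrite mulmxA IH 1?ltnW // -scalemxAl expr0 scale1r mulmxDr mulmx1 -/(jm j) vb //.
  rewrite bt // -[X in _ *: (X + _)]scale1r -scalerDl scalerA factS mulnC natrM.
  by rewrite -pmulrn -(natrD _ 1%N).
apply/eqP=> e; have /esym/eqP := vS t.+1 (leqnn _).
rewrite -{2}vP -mulmxA e mulmx0 scaler_eq0 (negPf v0) orbF pnatr_eq0.
by rewrite -leqn0 leqNgt fact_gt0.
Qed.

Lemma weight_exists (V : 'M[algC]_d) : V != 0 -> V *m P = V ->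
    (forall j, (j < k)%N -> stablemx V (X j)) ->
  exists a v, joint_eigen a v /\ (v <= V)%MS.
Proof.
move=> V0 VP VX.
have [//|||v [v0 vV va]] := @common_eigenvector_in _ V [seq X j | j <- iota 0 k].
- move=> _ _ /mapP[i + ->] /mapP[j + ->]; rewrite !mem_iota => ik jk.
  exact: jm_comm.
- by move=> _ /mapP[j + ->]; rewrite mem_iota; apply: VX.
have va' j : (j < k)%N -> exists a, v *m X j == a *: v.
  move=> jk; have [|a ->] := va (X j); last by exists a.
  by apply: map_f; rewrite mem_iota.
pose a j := if @idP (j < k)%N is ReflectT jk then xchoose (va' j jk) else 0.
exists a, v; split=> //; split=> //.
  by case/submxP: vV => D ->; rewrite -mulmxA VP.
move=> j jk; rewrite /a; case: {-}_ / idP => // jk'.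
exact/eqP/(xchooseP (va' j jk')).
Qed.

End JucysMurphy.

(** * Existence of large invariants *)

Lemma comm_mxZ (R : comPzRingType) n (A B : 'M[R]_n) a :
  comm_mx A B -> comm_mx A (a *: B).
Proof. by rewrite /comm_mx -scalemxAr -scalemxAl => ->. Qed.

Section SignTwist.
Variables (T : finType) (K0 : {set T}) (d : nat).
Variable rG : mx_representation algC (Sym K0) d.
Variable P : 'M[algC]_d.
Variables (k : nat) (x : nat -> T).
Hypothesis x_inj : {in gtn k &, injective x}.
Hypothesis xK : forall i, (i < k)%N -> x i \in K0.
Hypothesis P_comm : forall i j, (i < k)%N -> (j < k)%N ->
  comm_mx P (rG (tperm (x i) (x j))).

Lemma twist_mx_repr : mx_repr (Sym K0) (fun h => sg true h *: rG h).
Proof.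
split=> [|g h gK hK]; first by rewrite sg1 repr_mx1 scale1r.
by rewrite repr_mxM // sgM -scalemxAl -scalemxAr scalerA.
Qed.

Definition twist_repr := MxRepresentation twist_mx_repr.

Lemma twist_sym_sum (A : {set T}) : sym_sum twist_repr false A = sym_sum rG true A.
Proof. by apply: eq_bigr => h _; rewrite /sg expr0 scale1r. Qed.

Lemma twist_star y (I : {set T}) : y \notin I -> star_sum twist_repr y I = - star_sum rG y I.
Proof.
move=> yI; rewrite -sumrN; apply: eq_bigr => z zI /=.
by rewrite sg_tperm ?expr1 ?scaleN1r //; apply: contraNneq yI => <-.
Qed.

(** Tensoring with the sign character negates every Jucys-Murphy element and exchanges invariants
    with sign-invariants, which reduces the case [eps = true] to the positive one. *)
Lemma weight_invariants (eps : bool) a i : weight rG P k x a -> (i < k)%N ->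
  exists t, [/\ (t < k)%N, (-1) ^+ eps * a i <= t%:R
    & P *m sym_sum rG eps (initial x t.+1) != 0].
Proof.
case: eps => wa ik; last first.
  by have [t] := weight_invariants_pos x_inj xK P_comm wa ik; rewrite mul1r; exists t.
have P_comm' j l : (j < k)%N -> (l < k)%N -> comm_mx P (twist_repr (tperm (x j) (x l))).
  by move=> jk lk; rewrite /comm_mx -scalemxAr -scalemxAl P_comm.
have wa' : weight twist_repr P k x (fun j => - a j).
  have [v [v0 vP va]] := wa; exists v; split=> // j jk.
  rewrite /jm twist_star ?mulmxN ?va ?scaleNr //.
  by rewrite (x_initial x_inj) ?ltnn // ltnW.
have [t] := weight_invariants_pos x_inj xK P_comm' wa' ik.
by rewrite twist_sym_sum mulN1r; exists t.
Qed.

End SignTwist.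

(** * Sum of the squares of the Jucys-Murphy elements *)

Section SumOfSquares.
Variables (T : finType) (K0 : {set T}) (d : nat).
Variable rG : mx_representation algC (Sym K0) d.
Variable x : nat -> T.

Local Notation L := (initial x).

(* The off-diagonal terms of each [jm j ^ 2] and of each square of a full star
   are sums of 3-cycles; on the full side every 3-cycle is counted three times. *)
Lemma sum_jm_sqr k : {in gtn k &, injective x} ->
    (forall i, (i < k)%N -> x i \in K0) ->
  6 *: (\sum_(j < k) jm rG x j *m jm rG x j) =
  2 *: (\sum_(c in L k) star_sum rG c (L k :\ c) *m star_sum rG c (L k :\ c))
    + (k * k.-1)%:R%:M.
Proof.
elim: k => [|k IH] x_inj xK.
  by rewrite big_ord0 initial0 big_set0 !scaler0 add0r raddf0.
have inj' : {in gtn k &, injective x}.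
  by move=> i j ik jk; apply: x_inj; rewrite inE /= ltnW.
have xK' i : (i < k)%N -> x i \in K0 by move=> ik; rewrite xK // ltnW.
have xkL : x k \notin L k by rewrite (x_initial x_inj) ?ltnn.
have LK : L k \subset K0 by apply: (initial_sub xK).
have xkK : x k \in K0 by apply: xK.
rewrite big_ord_recr /= scalerDr IH // initialS big_setU1 //=.
rewrite setU1K //; set X := jm rG x k.
(* Conjugation by the transposition of [c] and [x k] exchanges the stars at these two points over
   [L k :\ c]. Hence the new terms combine with [X], and their sum over [c] is [2 X^2 - k]. *)
have step c : c \in L k ->
   star_sum rG c ((x k |: L k) :\ c) *m star_sum rG c ((x k |: L k) :\ c)
   = star_sum rG c (L k :\ c) *m star_sum rG c (L k :\ c)
     + (rG (tperm c (x k)) *m X + X *m rG (tperm c (x k)) - 1%:M).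
  move=> cL; have cK := subsetP LK c cL.
  have nek : x k != c by apply: contraNneq xkL => ->.
  have tK : tperm c (x k) \in Sym K0 by rewrite tperm_Sym.
  have tfix : tperm c (x k) @: (L k :\ c) = L k :\ c.
    apply: (@Sym_imset_disjoint _ [set c; x k]); first by rewrite tperm_Sym ?set21 ?set22.
    rewrite -setI_eq0; apply/eqP/setP=> z; rewrite !inE.
    apply/negP=> /andP[/orP[]/eqP-> /andP[]]; first by rewrite eqxx.
    by rewrite (negPf xkL).
  have sub : L k :\ c \subset K0 by apply: subset_trans LK; apply: subD1set.
  set t := rG (tperm c (x k)).
  have tt : t *m t = 1%:M by rewrite -repr_mxM // tperm2 repr_mx1.
  have -> : (x k |: L k) :\ c = x k |: (L k :\ c).
    by apply/setP=> z; rewrite !inE; case: eqP => [->|] //; rewrite eq_sym (negPf nek).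
  rewrite starU1 ?inE ?(negPf xkL) ?andbF // tpermC -/t.
  set Y := star_sum rG c (L k :\ c); set Z := star_sum rG (x k) (L k :\ c).
  have eX : X = t + Z.
    by rewrite /X /jm -{1}(setD1K cL) starU1 // !inE eqxx.
  have YZ : Y *m t = t *m Z by rewrite starJ // tfix tpermL.
  have ZY : Z *m t = t *m Y by rewrite starJ // tfix tpermR.
  rewrite eX !mulmxDl !mulmxDr YZ ZY tt.
  by clearbody Y Z t; apply/matrixP=> i j; rewrite !mxE; ring.
rewrite (eq_bigr _ step) !big_split /= sumrN sumr_const -mulmx_suml -mulmx_sumr.
rewrite (card_initial inj') // -/(star_sum rG (x k) (L k)) -/(jm rG x k) -/X.
set B := \sum_(c in _) _; set A := X *m X.
have -> : 1%:M *+ k = (k%:R%:M : 'M[algC]_d) by rewrite -scaler_nat scalemx1.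
have eM (m1 m2 : nat) : ((m1 + m2)%:R%:M : 'M[algC]_d) = m1%:R%:M + m2%:R%:M.
  by rewrite natrD raddfD.
have -> : (k.+1 * k.+1.-1)%N = (k * k.-1 + (k + k))%N by case: (k) => //= n; lia.
rewrite !eM; set M := k%:R%:M; set N := (k * k.-1)%:R%:M.
by clearbody A B M N; apply/matrixP=> i j; rewrite !mxE; ring.
Qed.

End SumOfSquares.

Section LargeWeights.
Variables (T : finType) (K0 : {set T}) (d : nat).
Variable rG : mx_representation algC (Sym K0) d.
Variable P : 'M[algC]_d.
Variables (k : nat) (x : nat -> T).
Hypothesis x_inj : {in gtn k &, injective x}.
Hypothesis xK : forall i, (i < k)%N -> x i \in K0.
Hypothesis P_comm : forall i j, (i < k)%N -> (j < k)%N ->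
  comm_mx P (rG (tperm (x i) (x j))).

(** Squares of self-adjoint stars have a nonnegative form, so evaluating [sum_jm_sqr] at a joint
    eigenvector gives [k (k - 1) <= 6 * sum a_j^2]; some term is at least the average. *)
Lemma large_weight a : (0 < k)%N -> weight rG P k x a ->
  exists2 j, (j < k)%N & (k.-1)%:R <= a j ^+ 2 *+ 6.
Proof.
move=> k0 wa; have aint := weight_int x_inj xK P_comm wa.
have [v [v0 _ va]] := wa.
have LK := initial_sub xK (leqnn k).
have vB : 0 <= hform rG (v *m \sum_(c in initial x k)
    star_sum rG c (initial x k :\ c) *m star_sum rG c (initial x k :\ c)) v.
  rewrite mulmx_sumr hform_suml; apply: sumr_ge0 => c cL.
  have sub : initial x k :\ c \subset K0 by apply: subset_trans LK; apply: subD1set.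
  by rewrite mulmxA hform_star ?hform_ge0 // (subsetP LK).
have /= := congr1 (fun A => hform rG (v *m A) v) (sum_jm_sqr rG x_inj xK).
rewrite mulmxDr hformDl .
rewrite -!scalemxAr !hformZl mul_mx_scalar hformZl.
have -> : v *m (\sum_(j < k) jm rG x j *m jm rG x j) = (\sum_(j < k) a j ^+ 2) *: v.
  rewrite mulmx_sumr scaler_suml; apply: eq_bigr => j _.
  by rewrite mulmxA va // -scalemxAl va // scalerA expr2.
rewrite hformZl mulrA => e.
have vv := hform_gt0 rG v0.
have le1 : (k * k.-1)%:R <= 6 * \sum_(j < k) a j ^+ 2.
  by rewrite -(ler_pM2r vv) e lerDr mulr_ge0.
have [/existsP[j le2]|/existsPn no] := boolP [exists j : 'I_k, (k.-1)%:R <= a j ^+ 2 *+ 6].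
  by exists (val j); first exact: ltn_ord.
have lt1 : 6 * \sum_(j < k) a j ^+ 2 < \sum_(j < k) (k.-1)%:R.
  rewrite mulr_sumr; apply: ltr_sum; first by apply/hasP; exists (Ordinal k0); rewrite ?mem_index_enum.
  (* The order on [algC] is partial; integrality of the weight is what turns the negated inequality
     into a strict one. *)
  move=> j _; have := no j; have [z -> _] := aint j (ltn_ord j).
  rewrite mulr_natl -rmorphXn -rmorphMn /= pmulrn ler_int ltr_int ltNge //.
by move: (le_lt_trans le1 lt1); rewrite sumr_const card_ord -[X in _ < X]mulr_natr -natrM mulnC ltxx.
Qed.

Lemma large_invariants : (0 < k)%N -> P != 0 -> P *m P = P ->
  exists eps t, [/\ (t < k)%N, (k <= 6 * t.+1 ^ 2)%N
    & P *m sym_sum rG eps (initial x t.+1) != 0].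
Proof.
move=> k0 P0 PP.
have [|a [v [av _]]] := weight_exists (rG := rG) x_inj xK (P := P) P0 PP.
  by move=> j jk; rewrite (P_comm_jm P_comm jk) submxMl.
have wa : weight rG P k x a by exists v.
have [j jk le6] := large_weight k0 wa.
have [z az _] := weight_int x_inj xK P_comm wa jk.
(* This choice of sign makes the signed eigenvalue equal to [|z|], so [|z| <= t]. *)
have [t [tk zt tP]] := weight_invariants x_inj xK P_comm (z < 0) wa jk.
exists (z < 0), t; split=> //.
have {}le6 : (k.-1)%:Z <= z ^+ 2 *+ 6.
  by rewrite -(ler_int algC) rmorphMn rmorphXn /= -az -pmulrn.
have {}zt : `|z| <= t%:Z.
  rewrite -(ler_int algC) -pmulrn (le_trans _ zt) // az.
  by case: ltrP => z0; rewrite ?expr1 ?expr0 ?mulN1r ?mul1r -?rmorphN /= ler_int; lia.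
nia.
Qed.

End LargeWeights.

Lemma trace_ge0_of_eigen d (A : 'M[algC]_d) :
  (forall a, eigenvalue A a -> 0 <= a) -> 0 <= \tr A.
Proof.
case: d A => [|d] A Age0; first by rewrite /mxtrace big_ord0.
have [s sE] := closed_field_poly_normal (char_poly A).
have mA : lead_coef (char_poly A) = 1 by apply/eqP/char_poly_monic.
rewrite mA scale1r in sE.
have sz : size s = d.+1.
  by apply: succn_inj; rewrite -(size_prod_XsubC s id) -sE size_char_poly.
have trE : \tr A = \sum_(z <- s) z.
  apply: oppr_inj; rewrite -char_poly_trace // sE -sz coefPn_prod_XsubC ?sz //.
rewrite trE big_seq; apply: sumr_ge0 => z zs; apply: Age0.
by rewrite eigenvalue_root_char sE root_prod_XsubC.
Qed.

Lemma initial_nth (T : finType) (y0 : T) (s : seq T) j : (j <= size s)%N ->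
  initial (nth y0 s) j = [set z in take j s].
Proof.
move=> js; apply/setP=> z; rewrite inE; apply/initialP/idP.
  by case=> i ij ->; rewrite -(nth_take y0 ij) mem_nth // size_takel.
move=> zs; have lt : (index z (take j s) < j)%N by rewrite -{2}(size_takel js) index_mem.
by exists (index z (take j s)); last by rewrite -(nth_take y0 lt) nth_index.
Qed.

(** * Growth of the invariants when one point is added to a block *)

Section DimensionStep.
Variables (T : finType) (K0 : {set T}) (d : nat).
Variable rG : mx_representation algC (Sym K0) d.
Variable c : nat.
Hypothesis small : forall eps (A : {set T}), A \subset K0 -> (c.+1 < #|A|)%N ->
  sym_sum rG eps A = 0.

(** A larger signed eigenvalue would give, by [weight_invariants], a nonzero signed sum over a set
    of more than [c.+1] points. *)
Lemma weight_bound k x a i (eps : bool) : {in gtn k &, injective x} ->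
    (forall i, (i < k)%N -> x i \in K0) -> weight rG 1%:M k x a -> (i < k)%N ->
  (-1) ^+ eps * a i <= c%:R.
Proof.
move=> x_inj xK wa ik.
have [|t [tk le nz]] := weight_invariants x_inj xK _ eps wa ik.
  by move=> *; apply: comm_mx_sym; apply: comm_mx1.
apply: le_trans le _; rewrite ler_nat leqNgt; apply: contraNN nz => ct.
by rewrite mul1mx small ?(initial_sub xK) // (card_initial x_inj).
Qed.

Variable P : 'M[algC]_d.
Variables (M R : {set T}) (eps : bool).
Hypothesis sMK : M \subset K0.
Hypothesis sRM : R \subset M.
Hypothesis PP : P *m P = P.
Hypothesis P_comm : forall g, g \in Sym M -> comm_mx P (rG g).

Local Notation S := (sym_sum rG eps R).
Local Notation N := (P *m S).
Let Z := \sum_(y in M :\: R) star_sum rG y R.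
Let sRK : R \subset K0 := subset_trans sRM sMK.

Lemma P_comm_sym_sum : comm_mx P S.
Proof.
apply: comm_mx_sum => h hR; apply: comm_mxZ; apply: P_comm.
exact: (subsetP (SymS sRM)).
Qed.

Lemma mul_sym_sum_sqr : N *m N = #|R|`!%:R *: N.
Proof.
rewrite mulmxA -[P *m S *m P]mulmxA -P_comm_sym_sum mulmxA PP -mulmxA.
by rewrite sym_sum_sqr // scalemxAr.
Qed.

Lemma mul_sym_sum_comm_cross : comm_mx N Z.
Proof.
apply: comm_mx_sum => y; rewrite inE => /andP[yR yM].
have yK := subsetP sMK y yM.
apply: comm_mx_sym; apply: comm_mxM; apply: comm_mx_sym.
  apply: comm_mx_sum => z zR; apply: P_comm.
  by rewrite tperm_Sym // (subsetP sRM).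
apply: comm_mx_sym; apply: comm_mx_sum => h hR; apply: comm_mxZ.
rewrite /comm_mx starJ ?(sub_Sym sRK) // (Sym_out hR yR).
by rewrite (Sym_imset_fix hR (subxx _)).
Qed.

(* Enumerating [M :\: R] before [R], the sum of the Jucys-Murphy elements at the
   positions of [R] is [Z] plus all transpositions inside [R]. *)
Lemma cross_eigen_bound (w : 'rV[algC]_d) al : w != 0 ->
    (forall h, h \in Sym R -> w *m rG h = sg eps h *: w) -> w *m Z = al *: w ->
  (-1) ^+ eps * al <= (#|R| * c)%:R.
Proof.
move=> w0 wR wZ.
have [R0|[y0 y0R]] := set_0Vmem R.
  have -> : al = 0.
    move/eqP: wZ; rewrite /Z R0 /star_sum big1 => [|y _]; last by rewrite big_set0.
    by rewrite mulmx0 eq_sym scaler_eq0 (negPf w0) orbF => /eqP.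
  by rewrite mulr0 ler0n.
pose s1 := enum (M :\: R); pose s2 := enum R; pose s := s1 ++ s2.
pose x := nth y0 s; pose r := #|R|; pose n1 := size s1; pose k := (n1 + r)%N.
have szs : size s = k by rewrite size_cat /k /r cardE.
have sM z : (z \in s) = (z \in M).
  rewrite mem_cat !mem_enum inE; case: (boolP (z \in R)) => //= zR.
    by rewrite (subsetP sRM).
  by rewrite orbF.
have us : uniq s.
  rewrite cat_uniq !enum_uniq andbT /=; apply/hasPn=> z; rewrite !mem_enum inE.
  by move=> ->.
have x_inj : {in gtn k &, injective x}.
  move=> i j; rewrite !inE -szs => ik jk /eqP; rewrite /x nth_uniq //.
  by move/eqP.
have xK i : (i < k)%N -> x i \in K0.
  by rewrite -szs => ik; rewrite (subsetP sMK) // -sM mem_nth.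
pose A := \sum_(i < r) jm rG x (n1 + i).
have ltk (i : 'I_r) : (n1 + i < k)%N by rewrite ltn_add2l.
have wA : w *m A = (al + (-1) ^+ eps * 'C(r, 2)%:R) *: w.
  have E (i : 'I_r) : w *m jm rG x (n1 + i) = w *m star_sum rG (x (n1 + i)%N) (M :\: R)
       + ((-1) ^+ eps * i%:R) *: w.
    rewrite /jm /x initial_nth -/x ?szs; last exact: ltnW.
    rewrite take_cat -/n1 ltnNge leq_addr /= addKn.
    have -> : [set z in s1 ++ take i s2] = (M :\: R) :|: [set z in take i s2].
      by apply/setP=> z; rewrite inE mem_cat mem_enum !inE.
    rewrite /star_sum (eq_bigl [predU (M :\: R) & [set z in take i s2]]) => [|z]; last by rewrite !inE.
    rewrite bigU /=; last first.
      rewrite disjoint_subset; apply/subsetP=> z; rewrite !inE => /andP[zR _].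
      by apply: contra zR => /mem_take; rewrite mem_enum.
    rewrite mulmxDr; congr (_ + _); rewrite mulmx_sumr.
    have xi : x (n1 + i)%N = nth y0 s2 i by rewrite /x nth_cat ltnNge leq_addr addKn.
    have i2 : (i < size s2)%N by rewrite -cardE.
    rewrite (eq_bigr (fun=> (-1) ^+ eps *: w)) => [|z]; last first.
      rewrite inE => zs; have zR : z \in R by rewrite -mem_enum (mem_take zs).
      rewrite wR ?sg_tperm //.
        rewrite xi; apply/eqP=> ze.
        have := index_uniq y0 i2 (enum_uniq R); rewrite -ze => ie.
        have : (index z s2 < i)%N.
          rewrite -[s2](cat_take_drop i) index_cat zs (leq_trans (n := size (take i s2))) ?index_mem //.
          by rewrite size_take; case: ltnP.
        by rewrite ie ltnn.
      by rewrite tperm_Sym // xi -mem_enum mem_nth.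
    rewrite sumr_const; have -> : #|[set z in take i s2]| = i.
      by rewrite cardsE (card_uniqP _) ?take_uniq ?enum_uniq // size_take i2.
    by rewrite -scaler_nat scalerA mulrC.
  rewrite mulmx_sumr (eq_bigr _ (fun i _ => E i)) big_split /= -scaler_suml.
  rewrite -mulr_sumr -natr_sum -[in 'C(r, 2)](bin2_sum r) big_mkord scalerDl; congr (_ + _).
  rewrite -wZ -mulmx_sumr; congr (_ *m _).
  transitivity (\sum_(z in R) star_sum rG z (M :\: R)).
    rewrite -[RHS]big_enum (big_nth y0) -cardE big_mkord /=.
    by apply: eq_bigr => i _; rewrite /x nth_cat ltnNge leq_addr addKn.
  rewrite /Z /star_sum exchange_big; apply: eq_bigr => y _; apply: eq_bigr => z _.
  by rewrite tpermC.
set be := al + _ in wA.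
(* [A] commutes with all Jucys-Murphy elements, so its eigenspace contains a joint eigenvector, and
   [be] is a sum of [r] weights bounded by [c]. *)
have nz : eigenspace A be != 0.
  apply: contraNneq w0 => V0; have : (w <= eigenspace A be)%MS by apply/eigenspaceP.
  by rewrite V0 submx0.
have [|a [v [[v0 _ va] vV]]] := weight_exists (rG := rG) x_inj xK (P := 1%:M) nz (mulmx1 _).
  move=> j jk; apply: comm_mx_stable_eigenspace; apply: comm_mx_sym.
  by apply: comm_mx_sum => i _; rewrite /comm_mx (jm_comm _ x_inj xK).
have wa : weight rG 1%:M k x a by exists v; split; rewrite ?mulmx1.
have bE : be = \sum_(i < r) a (n1 + i)%N.
  have /eigenspaceP := vV; rewrite mulmx_sumr.
  rewrite (eq_bigr (fun i : 'I_r => a (n1 + i)%N *: v)) => [|i _]; last by rewrite va.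
  rewrite -scaler_suml => /eqP; rewrite -subr_eq0 -scalerBl scaler_eq0 (negPf v0) orbF.
  by rewrite subr_eq0 => /eqP.
have : (-1) ^+ eps * be <= (r * c)%:R.
  rewrite bE mulr_sumr mulnC natrM.
  have -> : c%:R * r%:R = \sum_(i < r) c%:R :> algC by rewrite sumr_const card_ord mulr_natr.
  by apply: ler_sum => i _; apply: weight_bound wa _.
(* The transpositions inside [R] contribute the nonnegative number ['C(r, 2)], which is dropped. *)
apply: le_trans; rewrite /be mulrDr lerDl mulrA -signr_addb addbb mul1r.
exact: ler0n.
Qed.

(** The difference of the two sides is the trace of [Q = rc *: N - (-1) ^+ eps *: (N *m Z)]. An
    eigenvector of [Q] with nonzero eigenvalue is fixed by [N] up to [#|R|!], hence transforms under
    [Sym R] by [eps] and is an eigenvector of [Z]; [cross_eigen_bound] then makes its eigenvalue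
    nonnegative. *)
Lemma trace_cross_le : (-1) ^+ eps * \tr (N *m Z) <= (#|R| * c)%:R * \tr N.
Proof.
rewrite -subr_ge0 -mxtraceZ -mxtraceZ -raddfB /=.
apply: trace_ge0_of_eigen => q /eigenvalueP[w wQ w0].
set f : algC := #|R|`!%:R; have f0 : 0 < f by rewrite ltr0n fact_gt0.
set rc : algC := (_ * c)%:R in wQ *.
have [-> //|q0] := eqVneq q 0.
have QN : (rc *: N - (-1) ^+ eps *: (N *m Z)) *m N = f *: (rc *: N - (-1) ^+ eps *: (N *m Z)).
  have NZN : N *m Z *m N = f *: (N *m Z).
    by rewrite {1}mul_sym_sum_comm_cross -[LHS]mulmxA mul_sym_sum_sqr -scalemxAr mul_sym_sum_comm_cross.
  rewrite mulmxBl -!scalemxAl NZN mul_sym_sum_sqr -/f.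
  by rewrite scalerBr !scalerA ![f * _]mulrC.
have wN : w *m N = f *: w.
  apply: (scalerI q0); rewrite scalemxAl -wQ -mulmxA QN -scalemxAr wQ !scalerA.
  by rewrite mulrC.
have wZ : w *m Z = ((-1) ^+ eps * (rc - q / f)) *: w.
  have : q *: w = f *: (rc *: w - (-1) ^+ eps *: (w *m Z)).
    rewrite -wQ mulmxBr -!scalemxAr [w *m (_ *m Z)]mulmxA wN -scalemxAl scalerBr !scalerA.
    by rewrite ![f * _]mulrC.
  move/(congr1 (fun u => f^-1 *: u)); rewrite !scalerA mulVf ?gt_eqF // scale1r => e.
  have : (-1) ^+ eps *: (w *m Z) = rc *: w - (f^-1 * q) *: w by rewrite e opprB addrC subrK.
  move/(congr1 (fun u => (-1) ^+ eps *: u)); rewrite scalerA -signr_addb addbb scale1r.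
  by rewrite -scalerBl scalerA [f^-1 * q]mulrC.
have wR h : h \in Sym R -> w *m rG h = sg eps h *: w.
  move=> hR; apply: (scalerI (lt0r_neq0 f0)).
  by rewrite scalemxAl -wN -mulmxA -mulmxA sym_sum_mulr // -!scalemxAr wN !scalerA mulrC.
have := cross_eigen_bound w0 wR wZ.
rewrite mulrA -signr_addb addbb mul1r -/rc gerBl => le0.
by have := mulr_ge0 le0 (ltW f0); rewrite divfK ?gt_eqF.
Qed.

(** By [sym_sumU1] the increment of the trace comes from the star at [y]. Transpositions of
    [M :\: R] conjugate the stars at all points of [M :\: R] into one another while commuting with
    [N], so this star has the average trace of [Z]. *)
Lemma dimension_step y : y \in M -> y \notin R ->
  (#|M| - #|R|)%:R * (\tr (P *m sym_sum rG eps (y |: R)) - \tr N)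
    <= (#|R| * c)%:R * \tr N.
Proof.
move=> yM yR; apply: le_trans trace_cross_le.
rewrite sym_sumU1 //; last by rewrite subUset sub1set (subsetP sMK).
rewrite mulmxA mulmxDr mulmx1 raddfD /= addrC addKr -scalemxAr mxtraceZ mulrCA.
suff -> : \tr (N *m Z) = (#|M| - #|R|)%:R * \tr (N *m star_sum rG y R) by [].
rewrite mulmx_sumr raddf_sum /= (eq_bigr (fun=> \tr (N *m star_sum rG y R))).
  by rewrite sumr_const cardsD (setIidPr sRM) mulr_natl.
move=> y'; rewrite inE => /andP[y'R y'M].
have tM : tperm y y' \in Sym M by rewrite tperm_Sym.
have tK := sub_Sym sMK tM; set t := rG (tperm y y').
have tt : t *m t = 1%:M by rewrite -repr_mxM // tperm2 repr_mx1.
have tfix : tperm y y' @: R = R.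
  apply: (@Sym_imset_disjoint _ [set y; y']); first by rewrite tperm_Sym ?set21 ?set22.
  rewrite -setI_eq0; apply/eqP/setP=> z; rewrite !inE.
  by apply/negP=> /andP[/orP[]/eqP->]; apply/negP.
have Yt : star_sum rG y' R = t *m star_sum rG y R *m t.
  rewrite -mulmxA starJ ?(subsetP sMK) // tfix tpermL mulmxA tt mul1mx //.
have Nt : N *m t = t *m N.
  by rewrite -mulmxA sym_sumJ // tfix !mulmxA P_comm.
rewrite Yt !mulmxA Nt mxtrace_mulC !mulmxA tt mul1mx //.
Qed.

End DimensionStep.

(** * Sums over Young subgroups *)

Lemma drop_notin_take (T : eqType) i (s : seq T) z :
  uniq s -> z \in drop i s -> z \notin take i s.
Proof. by rewrite -{1}(cat_take_drop i s) cat_uniq => /and3P[_ /hasPn h _] /h. Qed.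

Definition sym_proj (T : finType) d (f : {perm T} -> 'M[algC]_d) eps (A : {set T}) : 'M_d :=
  (#|A|`!%:R)^-1 *: sym_sum f eps A.

(* Signed projections onto the isotypic parts of Young subgroups, summed over the
   ways to cut [ks] into blocks each of size at least a constant times the square
   root of what remains; [fuel] only ensures termination. *)
Fixpoint block_sum (T : finType) d (f : {perm T} -> 'M[algC]_d) fuel (ks : seq T) : 'M_d :=
  if fuel is fuel'.+1 then
    if ks is [::] then 1%:M else
    \sum_(t < size ks | (size ks <= 6 * t.+1 ^ 2)%N) \sum_(eps : bool)
      sym_proj f eps [set z in take t.+1 ks] *m block_sum f fuel' (drop t.+1 ks)
  else 1%:M.

Lemma trace_idempotent d (P : 'M[algC]_d) : P *m P = P -> \tr P = (\rank P)%:R.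
Proof.
move=> PP; rewrite -[in LHS](mulmx_base P) mxtrace_mulC.
suff -> : row_base P *m col_base P = 1%:M by rewrite mxtrace1.
have : col_base P *m (row_base P *m col_base P) *m row_base P
     = col_base P *m 1%:M *m row_base P.
  by rewrite mulmx1 mulmxA mulmx_base -mulmxA mulmx_base.
move/(row_free_inj (row_base_free P)).
have cf : row_full (col_base P) by apply: col_base_full.
by move/(row_full_inj cf).
Qed.

Lemma trace_idempotent_ge0 d (P : 'M[algC]_d) : P *m P = P -> 0 <= \tr P.
Proof. by move/trace_idempotent->; apply: ler0n. Qed.

Section BlockProjections.
Variables (T : finType) (K0 : {set T}) (d : nat).
Variable rG : mx_representation algC (Sym K0) d.

Lemma proj_idempotent (P : 'M[algC]_d) (A : {set T}) eps : A \subset K0 -> P *m P = P ->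
    (forall g, g \in Sym A -> comm_mx P (rG g)) ->
  P *m sym_proj rG eps A *m (P *m sym_proj rG eps A) = P *m sym_proj rG eps A.
Proof.
move=> sA PP PA; rewrite /sym_proj -!scalemxAr -scalemxAl !scalerA.
rewrite (mul_sym_sum_sqr eps sA (subxx A) PP PA) scalerA -mulrA mulVf ?mulr1 //.
by rewrite pnatr_eq0 -lt0n fact_gt0.
Qed.

Lemma proj_comm (P : 'M[algC]_d) (M A : {set T}) eps g : M \subset K0 -> A \subset M ->
    (forall g, g \in Sym M -> comm_mx P (rG g)) -> g \in Sym (M :\: A) ->
  comm_mx (P *m sym_proj rG eps A) (rG g).
Proof.
move=> sM sA PM gD; have gM := subsetP (SymS (subsetDl M A)) g gD.
rewrite /comm_mx -mulmxA /sym_proj -scalemxAl sym_sumJ ?(sub_Sym sM) //; last first.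
  exact: subset_trans sM.
rewrite (Sym_imset_disjoint gD) ?scalemxAr ?mulmxA ?PM //.
by rewrite -setI_eq0 setIDAC setDIl setDv setI0 // setIC setIA.
Qed.

(** For [P != 0], [large_invariants] supplies a block size and a sign for which the projected [P] is
    still nonzero, and induction gives that term trace at least 1; all other terms have nonnegative
    trace. *)
Lemma block_sum_ge fuel ks (P : 'M[algC]_d) : (size ks <= fuel)%N -> uniq ks ->
    {subset ks <= K0} -> P *m P = P ->
    (forall g, g \in Sym [set z in ks] -> comm_mx P (rG g)) ->
  (P != 0)%:R <= \tr (P *m block_sum rG fuel ks).
Proof.
elim: fuel ks P => [|fuel IH] ks P szk uk sk PP PM.
  rewrite /= mulmx1 trace_idempotent // ler_nat.
  by case: eqVneq => //= P0; rewrite lt0n mxrank_eq0.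
case: ks => [|y0 ks'] in szk uk sk PM *.
  rewrite /= mulmx1 trace_idempotent // ler_nat.
  by case: eqVneq => //= P0; rewrite lt0n mxrank_eq0.
set ks := y0 :: ks' in szk uk sk PM *; set k := size ks.
have -> : block_sum rG fuel.+1 ks = \sum_(t < k | (k <= 6 * t.+1 ^ 2)%N) \sum_(eps : bool)
      sym_proj rG eps [set z in take t.+1 ks] *m block_sum rG fuel (drop t.+1 ks) by [].
have k0 : (0 < size ks)%N by [].
rewrite {}/k; clearbody ks; set k := size ks in k0 *.
have sMK : [set z in ks] \subset K0 by apply/subsetP=> z; rewrite inE; apply: sk.
have sR t : [set z in take t ks] \subset [set z in ks].
  by apply/subsetP=> z; rewrite !inE; apply: mem_take.
have MD t : [set z in ks] :\: [set z in take t ks] = [set z in drop t ks].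
  apply/setP=> z; rewrite in_setD !in_set; have -> : (z \in ks) = (z \in take t ks) || (z \in drop t ks).
    by rewrite -mem_cat cat_take_drop.
  by apply/andP/idP=> [[/negPf-> //]|zd]; rewrite zd orbT (drop_notin_take uk).
have term t eps : (0 < t)%N ->
   (P *m sym_proj rG eps [set z in take t ks] != 0)%:R
     <= \tr (P *m (sym_proj rG eps [set z in take t ks] *m block_sum rG fuel (drop t ks))).
  move=> t0; rewrite mulmxA; apply: IH.
  - by rewrite size_drop; move: szk; rewrite /k; lia.
  - exact: drop_uniq.
  - by move=> z /mem_drop; apply: sk.
  - apply: proj_idempotent => //; first exact: subset_trans (sR t) sMK.
    by move=> g gR; apply: PM; apply: (subsetP (SymS (sR t))).
  - by move=> g gD; apply: (proj_comm _ sMK (sR t) PM); rewrite MD.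
have termge0 t eps : (0 < t)%N ->
   0 <= \tr (P *m (sym_proj rG eps [set z in take t ks] *m block_sum rG fuel (drop t ks))).
  by move=> t0; apply: le_trans (term t eps t0); apply: ler0n.
rewrite mulmx_sumr raddf_sum /=.
have [->|P0] := eqVneq P 0.
  by apply: sumr_ge0 => t _; rewrite mul0mx mxtrace0.
pose x := nth y0 ks.
have x_inj : {in gtn k &, injective x}.
  by move=> i j; rewrite !inE => ik jk /eqP; rewrite /x nth_uniq // => /eqP.
have xks i : (i < k)%N -> x i \in ks by move=> ik; apply: mem_nth.
have [|||eps [t [tk k6 nz]]] := @large_invariants _ K0 _ rG P k x x_inj _ _ _ P0 PP.
- by move=> i ik; apply: sk; apply: xks.
- by move=> i j ik jk; apply: PM; rewrite tperm_Sym ?in_set ?xks.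
- by [].
rewrite (bigD1 (Ordinal tk)) //= -[X in X <= _]addr0 lerD //; last first.
  apply: sumr_ge0 => i _; rewrite mulmx_sumr raddf_sum /=; apply: sumr_ge0 => e _.
  exact: (termge0 i.+1 e isT).
rewrite mulmx_sumr raddf_sum /= (bigD1 eps) //= -[X in X <= _]addr0 lerD //; last first.
  by apply: sumr_ge0 => e _; apply: (termge0 t.+1 e isT).
apply: le_trans (term t.+1 eps isT); rewrite ler_nat lt0b /sym_proj -scalemxAr.
rewrite scaler_eq0 negb_or invr_eq0 pnatr_eq0 -lt0n fact_gt0 /=.
by rewrite /x initial_nth in nz.
Qed.

End BlockProjections.

(** * Upper bound for the trace of the block sum *)

Lemma expnn_le_fact t : (t ^ t <= 4 ^ t * t`!)%N.
Proof.
(* The comparison passes through [(2t)!]: it is at least [t ^ t * t!], and at most [4 ^ t * t! ^ 2]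
   since a central binomial coefficient is at most [4 ^ t]. *)
have h1 : (t ^ t * t`! <= (t + t)`!)%N.
  elim: {2 5}t => [|i IH]; first by rewrite expn0 mul1n addn0.
  by rewrite addnS factS expnS -mulnA leq_mul //; lia.
have h2 : ((t + t)`! <= 4 ^ t * (t`! * t`!))%N.
  rewrite -(bin_fact (leq_addr t t)) addnK leq_mul2r; apply/orP; right.
  have tlt : (t < (t + t).+1)%N by lia.
  rewrite (_ : 4 = (1 + 1) ^ 2)%N // -expnM mul2n -addnn expnDn.
  by rewrite (bigD1 (Ordinal tlt)) //= !exp1n !muln1 leq_addr.
have := leq_trans h1 h2; rewrite mulnA leq_pmul2r ?fact_gt0 //.
Qed.

(** Since 36 is three times 12, the summands divided by [36 ^ k] are [2 / 3 ^ (t + 1)], with total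
    at most 1. The factor 2 counts the two signs of a block. *)
Lemma geometric_split k : (\sum_(t < k) 2 * (12 ^ t.+1 * 36 ^ (k - t.+1)) <= 36 ^ k)%N.
Proof.
elim: k => [|k IH]; first by rewrite big_ord0.
rewrite big_ord_recl /= subn1 /= (eq_bigr (fun t : 'I_k => 12 * (2 * (12 ^ t.+1 * 36 ^ (k - t.+1))))%N).
  rewrite -big_distrr /= [(36 ^ k.+1)%N]expnS; move: IH; set s := (\sum_(_ < _) _)%N; set u := (36 ^ k)%N; lia.
by move=> t _; rewrite /bump /= add1n subSS [(12 ^ t.+2)%N]expnS; lia.
Qed.

(** Cost of one point: [j.+1] points of the list remain to be treated and [e + j.+1] points of the
    ambient set. The excess [e] does not change when a block is removed from both. *)
Definition growth c e j : algC := (sqrtC (j.+1)%:R)^-1 + c%:R / (e + j.+1)%:R.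

Lemma growth_ge0 c e j : 0 <= growth c e j.
Proof. by rewrite addr_ge0 ?invr_ge0 ?sqrtC_ge0 ?divr_ge0 ?ler0n. Qed.

Section BlockUpperBound.
Variables (T : finType) (K0 : {set T}) (d : nat).
Variable rG : mx_representation algC (Sym K0) d.
Variable c : nat.
Hypothesis small : forall eps (A : {set T}), A \subset K0 -> (c.+1 < #|A|)%N ->
  sym_sum rG eps A = 0.

Section OneBlock.
Variables (P : 'M[algC]_d) (M : {set T}) (ks : seq T) (eps : bool).
Hypothesis sMK : M \subset K0.
Hypothesis PP : P *m P = P.
Hypothesis P_comm : forall g, g \in Sym M -> comm_mx P (rG g).
Hypothesis uks : uniq ks.
Hypothesis sks : {subset ks <= M}.

Let R i : {set T} := [set z in take i ks].
Let a i := \tr (P *m sym_sum rG eps (R i)).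

Lemma sub_take i : R i \subset M.
Proof. by apply/subsetP=> z; rewrite inE => /mem_take; apply: sks. Qed.

Lemma card_take i : (i <= size ks)%N -> #|R i| = i.
Proof.
by move=> le; rewrite cardsE (card_uniqP _) ?take_uniq // size_takel.
Qed.

Lemma trace_proj i : (i <= size ks)%N ->
  a i = i`!%:R * \tr (P *m sym_proj rG eps (R i)).
Proof.
move=> le; rewrite /sym_proj card_take // -scalemxAr mxtraceZ mulrA mulfV ?mul1r //.
by rewrite pnatr_eq0 -lt0n fact_gt0.
Qed.

Lemma trace_sum_ge0 i : (i <= size ks)%N -> 0 <= a i.
Proof.
move=> le; rewrite trace_proj // mulr_ge0 ?ler0n // trace_idempotent_ge0 //.
apply: proj_idempotent => //; first exact: subset_trans (sub_take i) sMK.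
by move=> g gR; apply: P_comm; apply: (subsetP (SymS (sub_take i))).
Qed.

Lemma size_le_M : (size ks <= #|M|)%N.
Proof. by rewrite -(card_uniqP uks); apply: subset_leq_card; apply/subsetP. Qed.

(** [dimension_step] gives the numerator [i * c]; enlarging it to [t * c] allows a common factor [t]
    to be extracted from every step of a block of size [t]. *)
Lemma trace_block_step t i : (i < t)%N -> (t <= size ks)%N ->
  a i.+1 <= a i * (1 + (t * c)%:R / (#|M| - i)%:R).
Proof.
move=> it tk; have ik : (i < size ks)%N := leq_trans it tk.
have iM := leq_trans ik size_le_M.
have m0 : 0 < (#|M| - i)%:R :> algC by rewrite ltr0n subn_gt0.
have [y0 _] : exists y : T, True by case: (ks) ik => // y; exists y.
pose y := nth y0 ks i.
have Ri : R i.+1 = y |: R i.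
  by apply/setP=> z; rewrite !inE (take_nth y0) // mem_rcons inE.
have yR : y \notin R i.
  by rewrite inE drop_notin_take // (drop_nth y0) // mem_head.
have := dimension_step small eps sMK (sub_take i) PP P_comm (sks (mem_nth y0 ik)) yR.
rewrite card_take 1?ltnW // -/y -Ri -/(a _) -/(a _) => le.
rewrite mulrDr mulr1 -lerBlDl -(ler_pM2l m0) (le_trans le) //.
rewrite mulrCA [(#|M| - i)%:R * _]mulrC divfK ?gt_eqF // mulrC.
apply: ler_wpM2l; first by apply: trace_sum_ge0; apply: ltnW.
by rewrite ler_nat leq_mul2r (ltnW it) orbT.
Qed.

(** Extracting [t] from each of the [t] steps leaves [t ^ t <= 4 ^ t * t!], and the factorial
    cancels the normalization of the projector. As [size ks <= 6 * t ^ 2 <= (3 * t) ^ 2], the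
    remaining [1 / t] is at most 3 over the square root in [growth]; hence 12 = 4 * 3. *)
Lemma trace_block t : (0 < t <= size ks)%N -> (size ks <= 6 * t ^ 2)%N ->
  \tr (P *m sym_proj rG eps (R t)) <=
  \tr P * (12 ^+ t * \prod_(i < t) growth c (#|M| - size ks) (size ks - i.+1)).
Proof.
move=> /andP[t0 tk] k6; have tr0 : 0 <= \tr P by apply: trace_idempotent_ge0.
have f0 : 0 < t`!%:R :> algC by rewrite ltr0n fact_gt0.
have tn0 : 0 < t%:R :> algC by rewrite ltr0n.
have prodc (z : algC) : z ^+ t = \prod_(i < t) z by rewrite prodr_const card_ord.
have b i : (i <= t)%N -> a i <= \tr P * \prod_(j < i) (1 + (t * c)%:R / (#|M| - j)%:R).
  elim: i => [|i IH] it.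
    rewrite big_ord0 mulr1 /a /R take0; have -> : [set z in [::]] = set0 :> {set T}.
      by apply/setP=> z; rewrite !inE.
    rewrite /sym_sum (big_pred1 1%g) => [|g /=]; last first.
      rewrite in_Sym; apply/idP/eqP=> [g0|->]; last exact: perm_on1.
      by apply/permP=> y; rewrite perm1 (out_perm g0) ?inE.
    by rewrite sg1 repr_mx1 scale1r mulmx1.
  apply: le_trans (trace_block_step it tk) _.
  rewrite big_ord_recr /= mulrA ler_wpM2r ?IH // 1?ltnW //.
  by rewrite addr_ge0 ?divr_ge0 ?ler0n.
rewrite -(ler_pM2l f0) -trace_proj // (le_trans (b t (leqnn t))) //.
rewrite mulrCA ler_wpM2l //.
have le4 : t%:R ^+ t <= 4 ^+ t * t`!%:R :> algC.
  by rewrite -!natrX -natrM ler_nat expnn_le_fact.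
apply: le_trans (_ : t%:R ^+ t * \prod_(i < t) (t%:R^-1 + c%:R / (#|M| - i)%:R) <= _).
  rewrite [_ ^+ t]prodc -big_split /=; apply: ler_prod => i _.
  rewrite addr_ge0 ?divr_ge0 ?ler0n //= mulrDr mulfV ?gt_eqF // natrM mulrA //.
apply: le_trans (_ : 4 ^+ t * t`!%:R * \prod_(i < t) (t%:R^-1 + c%:R / (#|M| - i)%:R) <= _).
  apply: ler_wpM2r => //; apply: prodr_ge0 => i _.
  by rewrite addr_ge0 ?divr_ge0 ?invr_ge0 ?ler0n.
rewrite [4 ^+ t * _]mulrC -mulrA ler_pM2l //.
have -> : (12 : algC) = 4 * 3 by rewrite -natrM.
rewrite exprMn -mulrA ler_pM2l ?exprn_gt0 ?ltr0n //.
rewrite [_ ^+ t]prodc -big_split /=; apply: ler_prod => i _.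
rewrite addr_ge0 ?divr_ge0 ?invr_ge0 ?ler0n //= /growth mulrDr.
have ik : (i < size ks)%N := leq_trans (ltn_ord i) tk.
have kM := size_le_M.
have -> : (size ks - i.+1).+1 = (size ks - i)%N by lia.
have -> : (#|M| - size ks + (size ks - i) = #|M| - i)%N by lia.
have k0 : 0 < sqrtC (size ks - i)%:R :> algC by rewrite sqrtC_gt0 ltr0n subn_gt0.
apply: lerD.
  rewrite ler_pdivlMr // mulrC ler_pdivrMr // -[_ * _]ger0_norm ?mulr_ge0 ?ler0n //.
  rewrite -(@ler_pXn2r _ 2) ?nnegrE ?sqrtC_ge0 ?normr_ge0 ?ler0n //.
  rewrite sqrtCK ger0_norm ?mulr_ge0 ?ler0n // -natrM -natrX ler_nat.
  by nia.
rewrite ler_peMl ?divr_ge0 ?ler0n //.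
by rewrite ler1n.
Qed.

End OneBlock.

(** The first block is bounded by [trace_block], the rest by induction inside [M] minus that block.
    The growth factors reassemble into the full product, and [geometric_split] absorbs the sum over
    block sizes and signs. *)
Lemma block_sum_le fuel ks (P : 'M[algC]_d) (M : {set T}) : (size ks <= fuel)%N ->
    M \subset K0 -> uniq ks -> {subset ks <= M} -> P *m P = P ->
    (forall g, g \in Sym M -> comm_mx P (rG g)) ->
  \tr (P *m block_sum rG fuel ks) <=
  \tr P * (36 ^+ size ks * \prod_(j < size ks) growth c (#|M| - size ks) j).
Proof.
elim: fuel ks P M => [|fuel IH] ks P M szk sM uk sk PP PM.
  by case: ks szk {uk sk} => //= _; rewrite mulmx1 big_ord0 !mulr1.
case: ks => [|y0 ks'] in szk uk sk *.
  by rewrite /= mulmx1 big_ord0 !mulr1.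
set ks := y0 :: ks' in szk uk sk *; set k := size ks; set e := (#|M| - k)%N.
have -> : block_sum rG fuel.+1 ks = \sum_(t < k | (k <= 6 * t.+1 ^ 2)%N) \sum_(eps : bool)
      sym_proj rG eps [set z in take t.+1 ks] *m block_sum rG fuel (drop t.+1 ks) by [].
rewrite {}/e {}/k; clearbody ks; set k := size ks; set e := (#|M| - k)%N.
have tr0 : 0 <= \tr P by apply: trace_idempotent_ge0.
set G := \prod_(j < k) _.
have G0 : 0 <= G by apply: prodr_ge0 => j _; apply: growth_ge0.
have kM : (k <= #|M|)%N by apply: size_le_M.
have term (t : 'I_k) eps : (k <= 6 * t.+1 ^ 2)%N ->
   \tr (P *m (sym_proj rG eps [set z in take t.+1 ks] *m block_sum rG fuel (drop t.+1 ks)))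
   <= \tr P * G * (12 ^ t.+1 * 36 ^ (k - t.+1))%:R.
  move=> k6; have tk : (t < k)%N := ltn_ord t.
  have sR := sub_take sk t.+1; set R := [set z in _] in sR *.
  have cR : #|R| = t.+1 by apply: card_take.
  rewrite mulmxA; apply: le_trans (IH _ _ (M :\: R) _ _ _ _ _ _) _.
  - by rewrite size_drop; move: szk; rewrite /k; lia.
  - exact: subset_trans (subsetDl _ _) sM.
  - exact: drop_uniq.
  - by move=> z zd; rewrite !inE (sk _ (mem_drop zd)) andbT drop_notin_take.
  - apply: proj_idempotent => //; first exact: subset_trans sR sM.
    by move=> g gR; apply: PM; apply: (subsetP (SymS sR)).
  - by move=> g; apply: proj_comm.
  have -> : (#|M :\: R| - size (drop t.+1 ks) = e)%N.
    by rewrite cardsD (setIidPr sR) cR size_drop -/k /e; move: kM tk; clear; lia.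
  rewrite size_drop -/k.
  have le1 : \tr (P *m sym_proj rG eps R) <=
     \tr P * (12 ^+ t.+1 * \prod_(i < t.+1) growth c e (k - i.+1)).
    exact: trace_block.
  set G1 := \prod_(j < k - t.+1) _.
  have G10 : 0 <= 36 ^+ (k - t.+1) * G1.
    by rewrite mulr_ge0 ?exprn_ge0 ?ler0n // prodr_ge0 // => j _; apply: growth_ge0.
  apply: le_trans (ler_wpM2r G10 le1) _; rewrite le_eqVlt; apply/orP; left; apply/eqP.
  have -> : G = G1 * \prod_(i < t.+1) growth c e (k - i.+1).
    rewrite /G /G1 -!(big_mkord xpredT) (big_cat_nat (n := (k - t.+1)%N)) //= ?leq_subr //.
    congr (_ * _); rewrite -{1}[(k - t.+1)%N]add0n big_addn subKn //.
    rewrite !big_mkord [LHS](reindex_inj rev_ord_inj) /=; apply: eq_bigr => i _.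
    by congr growth; move: (ltn_ord i); lia.
  by rewrite natrM !natrX; ring.
rewrite mulmx_sumr raddf_sum /=.
apply: le_trans (_ : \sum_(t < k) \tr P * G * (2 * (12 ^ t.+1 * 36 ^ (k - t.+1)))%:R <= _).
  rewrite big_mkcond /=; apply: ler_sum => t _; case: ifP => k6; last first.
    by rewrite !mulr_ge0 ?ler0n.
  rewrite mulmx_sumr raddf_sum /= (bigD1 true) //= (bigD1 false) //= big1 => [|[]] //.
  rewrite addr0 mul2n -addnn natrD mulrDr.
  by apply: lerD; apply: term.
rewrite -mulr_sumr -natr_sum -mulrA ler_wpM2l // mulrC ler_wpM2r //.
by rewrite -natrX ler_nat geometric_split.
Qed.

End BlockUpperBound.

(** * Specht modules *)

Section SpechtVanishing.
Variables (n : nat) (la : seq nat).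
Hypothesis la_part : is_part n la.

Local Notation G := [set: 'S_n]%G.
Local Notation aG := (regular_repr algC G).
(** The lemmas on signed sums concern groups of the form [Sym K0]; this restriction to all of ['S_n]
    brings the regular representation into that form. *)
Let aS := subg_repr aG (subsetT (Sym [set: 'I_n])).

Lemma pigeonhole (T : finType) (f : T -> nat) m (B : {set T}) :
    (forall x, (f x < m)%N) -> (m < #|B|)%N ->
  exists x y, [/\ x \in B, y \in B, x != y & f x = f y].
Proof.
move=> fm ltB; pose g x : 'I_m := Ordinal (fm x).
have /dinjectivePn[x xB [y]] : ~~ dinjectiveb g B.
  apply: contraTN ltB => /dinjectiveP gB; rewrite -leqNgt.
  by rewrite -(card_in_imset gB) -[m in (_ <= m)%N]card_ord max_card.
rewrite inE => /andP[yx yB] gxy; exists x, y; split=> //; first by rewrite eq_sym.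
by have := congr1 val gxy.
Qed.

Lemma sym_sum_swap eps (x y : 'I_n) (B : {set 'I_n}) : x \in B -> y \in B -> x != y ->
  aG (tperm x y) *m sym_sum aG eps B = (-1) ^+ eps *: sym_sum aG eps B.
Proof.
move=> xB yB xy; have := sym_sum_mull aS eps (subsetT B) (tperm_Sym xB yB).
by rewrite sg_tperm.
Qed.

Lemma eq_opp_mx0 m1 m2 (A : 'M[algC]_(m1, m2)) : A = - A -> A = 0.
Proof.
move/eqP; rewrite -addr_eq0 -mulr2n -scaler_nat scaler_eq0 pnatr_eq0 /=.
by move/eqP.
Qed.

(** The set [B] has more points than there are rows and columns. For the sign, two points share a
    row: their transposition is absorbed by the row symmetrizer but negates the signed sum. For the
    trivial character, two points share a column and the roles are reversed. *)
Lemma young_sym_sum0 eps (B : {set 'I_n}) : ((maxn (head 0 la) (size la)).-1.+1 < #|B|)%N ->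
  young_symmetrizer n la *m sym_sum aG eps B = 0.
Proof.
have /and3P[la_sorted la0 /eqP la_sum] := la_part.
move=> ltB; have xn (x : 'I_n) : (x < sumn la)%N by rewrite la_sum.
have head_max i : (nth 0 la i <= head 0 la)%N.
  have [lti|/(nth_default 0)->//] := ltnP i (size la).
  rewrite -nth0; case: i lti => // i lti.
  have geq_trans : transitive geq by move=> a b c /= ba cb; apply: leq_trans cb ba.
  by apply: (sorted_ltn_nth geq_trans 0%N la_sorted 0%N i.+1); rewrite ?inE //; lia.
rewrite /young_symmetrizer -mulmxA; case: eps.
- rewrite [X in _ *m X]mulmx_suml mulmx_sumr big1 // => q _.
  rewrite -scalemxAl -scalemxAr.
  (* The column factor stands between the row symmetrizer and the signed sum. Moving the sum past
     [q] replaces [B] by a translate of the same size. *)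
  have -> : aG q *m sym_sum aG true B = sym_sum aG true (q^-1%g @: B) *m aG q.
    have /= -> := sym_sumJ aS true (subsetT (q^-1%g @: B)) (_ : q \in Sym _).
      congr (_ *m sym_sum _ _ _); rewrite -imset_comp -[LHS]imset_id.
      by apply: eq_imset => x /=; rewrite permKV.
    by rewrite in_Sym; apply/subsetP=> x; rewrite inE.
  have cB : #|q^-1%g @: B| = #|B| by rewrite card_imset //; apply: perm_inj.
  have [||x [y [xB yB xy exy]]] := @pigeonhole _ (fun x : 'I_n => reshape_index la x)
      (size la) (q^-1%g @: B).
  - by move=> x; apply: reshape_indexP.
  - by rewrite cB; apply: leq_ltn_trans ltB; lia.
  set S := sym_sum _ _ _; suff -> : (\sum_(p in row_stab n la) aG p) *m (S *m aG q) = 0.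
    by rewrite scaler0.
  rewrite mulmxA; suff -> : (\sum_(p in row_stab n la) aG p) *m S = 0 by rewrite mul0mx.
  apply: eq_opp_mx0; rewrite -[in RHS]mulmxN.
  have -> : - S = aG (tperm x y) *m S by rewrite sym_sum_swap // expr1 scaleN1r.
  rewrite mulmxA; congr (_ *m _); rewrite mulmx_suml.
  rewrite (reindex_inj (mulIg (tperm x y))) /=; apply: eq_big => [p|p _].
    rewrite !inE; apply/forallP/forallP=> pR z; have := pR z; rewrite permM.
      by case: tpermP => [->|->|//]; rewrite ?exy // -exy.
    by case: tpermP => [->|->|//]; rewrite ?exy // -exy.
  by rewrite repr_mxM ?inE.
suff -> : (\sum_(q in col_stab n la) (-1) ^+ q *: aG q) *m sym_sum aG false B = 0.
  by rewrite mulmx0.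
have [||x [y [xB yB xy exy]]] := @pigeonhole _ (fun x : 'I_n => reshape_offset la x)
      (head 0%N la) B.
- by move=> x; apply: leq_trans (reshape_offsetP (xn x)) _.
- by apply: leq_ltn_trans ltB; lia.
set S := sym_sum _ _ _; apply: eq_opp_mx0.
have {1}-> : S = aG (tperm x y) *m S by rewrite sym_sum_swap // expr0 scale1r.
rewrite mulmxA -mulNmx; congr (_ *m _); rewrite mulmx_suml -sumrN.
rewrite [RHS](reindex_inj (mulIg (tperm x y))) /=; apply: eq_big => [p|p _].
  rewrite !inE; apply/forallP/forallP=> pR z; have := pR z; rewrite permM.
    by case: tpermP => [->|->|//]; rewrite ?exy // -exy.
  by case: tpermP => [->|->|//]; rewrite ?exy // -exy.
rewrite -scalemxAl -repr_mxM ?inE // odd_permM odd_tperm xy signr_addb expr1.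
by rewrite mulrN1 scaleNr opprK.
Qed.

(** The Specht module is spanned by right translates of the Young symmetrizer; moving a signed sum
    past a translation only replaces [B] by another set of the same cardinality. *)
Lemma specht_sym_sum0 eps (B : {set 'I_n}) : ((maxn (head 0 la) (size la)).-1.+1 < #|B|)%N ->
  sym_sum (specht_repr n la) eps B = 0.
Proof.
move=> ltB; set U := specht_mx n la.
have U0 : U *m sym_sum aG eps B = 0.
  apply/row_matrixP=> i; rewrite row_mul row0.
  have /cyclic_mxP[A /envelop_mxP[a ->] ->] : (row i U <= U)%MS by apply: row_sub.
  rewrite -mulmxA mulmx_suml mulmx_sumr big1 // => g _.
  rewrite -scalemxAl -scalemxAr.
  have -> : aG g *m sym_sum aG eps B = sym_sum aG eps (g^-1%g @: B) *m aG g.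
    have /= -> := sym_sumJ aS eps (subsetT (g^-1%g @: B)) (_ : g \in Sym _).
      congr (_ *m sym_sum _ _ _); rewrite -imset_comp -[LHS]imset_id.
      by apply: eq_imset => x /=; rewrite permKV.
    by rewrite in_Sym; apply/subsetP=> x; rewrite inE.
  rewrite mulmxA -gring_row_mul young_sym_sum0; last first.
    by rewrite card_imset //; apply: perm_inj.
  by rewrite linear0 mul0mx scaler0.
have -> : sym_sum (specht_repr n la) eps B = in_submod U (val_submod (U := U) 1%:M *m sym_sum aG eps B).
  rewrite mulmx_sumr linear_sum; apply: eq_bigr => g _.
  by rewrite -scalemxAr linearZ.
have [D ->] : exists D, val_submod (U := U) 1%:M = D *m U by apply/submxP; apply: val_submodP.
by rewrite -mulmxA U0 mulmx0 linear0.
Qed.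

End SpechtVanishing.

(** * Supports, lengths and centralizers *)

Section PermCounts.
Variable T : finType.
Implicit Types s : {perm T}.

Lemma supp_prod_tperm (ts : seq (T * T)) :
  (supp_size (\prod_(t <- ts) tperm t.1 t.2)%g <= 2 * size ts)%N.
Proof.
elim: ts => [|[x y] ts IH]; rewrite /supp_size.
  by rewrite big_nil leqn0 cards_eq0; apply/eqP/setP=> z; rewrite !inE perm1 eqxx.
rewrite big_cons /= mulnS; set p := (\prod_(t <- ts) _)%g in IH *.
have sub : [set z | (tperm x y * p)%g z != z] \subset [set x; y] :|: [set z | p z != z].
  apply/subsetP=> z; rewrite !inE permM; case: tpermP => [->|->|] //.
  - by rewrite eqxx.
  - by rewrite eqxx orbT.
  - by move=> _ _ ->; rewrite orbT.
apply: leq_trans (subset_leq_card sub) _; apply: leq_trans (leq_card_setU _ _) _.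
by rewrite leq_add // cards2; case: (x != y).
Qed.

Lemma supp_le_perm_len s : (supp_size s <= 2 * perm_len s)%N.
Proof.
rewrite /perm_len; case: ex_minnP => m /existsP[ts /andP[_ /eqP->]] _.
by apply: leq_trans (supp_prod_tperm ts) _; rewrite size_tuple.
Qed.

(** Multiplying by [tperm x (s x)] with [x] moved by [s] raises the number of cycles by one;
    induction stops at the identity. *)
Lemma prod_tperm_porbits s :
  is_prod_of_transpositions s (#|T| - #|porbits s|).
Proof.
have [m] := ubnP (#|T| - #|porbits s|)%N; elim: m s => // m IH s ltm.
have [->|s1] := eqVneq s 1%g.
  have -> : #|porbits (1 : {perm T})| = #|T|.
    rewrite card_imset // => x y /eqP; rewrite eq_porbit_mem => /porbitP[i ->].
    by rewrite expg1n perm1.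
  rewrite subnn; apply/existsP; exists [tuple]; rewrite /= big_nil eqxx //.
have [x sx] : exists x, s x != x.
  apply/existsP; apply: contraNT s1 => /existsPn s1; apply/eqP/permP=> x.
  by rewrite perm1; apply/eqP; have := s1 x; rewrite negbK.
have := porbits_mul_tperm s x (s x); rewrite /= eq_sym sx.
have -> : x \in porbit s (s x) by rewrite porbit_sym (mem_porbit s 1).
rewrite addn0 addn1; set s' := (tperm x (s x) * s)%g => eN.
have leN : (#|porbits s'| <= #|T|)%N by apply: leq_imset_card.
have [lt' eT] : (#|T| - #|porbits s'| < m)%N
    /\ (#|T| - #|porbits s| = (#|T| - #|porbits s'|).+1)%N.
  move: ltm leN; rewrite eN; set a := #|T|; set b := #|porbits s|; lia.
have /existsP[ts] := IH s' lt'.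
move=> /andP[tsd /eqP ets]; rewrite eT; apply/existsP.
exists [tuple of (x, s x) :: ts]; rewrite /= big_cons -ets /= tsd andbT /dpair /= eq_sym sx /=.
by rewrite /s' mulgA tperm2 mul1g.
Qed.

Lemma perm_len_le s : (perm_len s <= #|T| - #|porbits s|)%N.
Proof.
by rewrite /perm_len; case: ex_minnP => m _; apply; apply: prod_tperm_porbits.
Qed.

(* A permutation commuting with [s] is determined by its values on one point of
   each cycle of [s]. *)
Lemma card_centralizer s : s != 1%g ->
  exists2 p, (#|('C_(Sym [set x | s x != x])[s])%g| <= supp_size s ^ p)%N
    & (p + perm_len s <= supp_size s)%N.
Proof.
move=> s1; set K := [set x | s x != x]; rewrite -/(supp_size s) /supp_size -/K.
have [x0 sx0] : exists x, s x != x.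
  apply/existsP; apply: contraNT s1 => /existsPn s1; apply/eqP/permP=> x.
  by rewrite perm1; apply/eqP; have := s1 x; rewrite negbK.
pose rep x := odflt x [pick y in porbit s x].
have rep_in x : rep x \in porbit s x.
  by rewrite /rep; case: pickP => [//|/(_ x)]; rewrite porbit_id.
have rep_eq x y : porbit s x = porbit s y -> rep x = rep y.
  move=> e; rewrite /rep -e; case: pickP => // /(_ x); rewrite porbit_id //.
have repK x : rep (rep x) = rep x.
  by apply: rep_eq; apply/eqP; rewrite eq_porbit_mem.
have fixP z : z \notin K -> porbit s z = [set z].
  rewrite inE negbK => /eqP sz; apply/setP=> y; rewrite inE porbit_sym.
  apply/idP/eqP=> [|->]; last exact: porbit_id.
  rewrite porbit_sym => /porbitP[i ->]; elim: i => [|i IH]; first by rewrite perm1.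
  by rewrite expgSr permM IH sz.
pose X := [set x in K | rep x == x].
(* Representatives of the nontrivial cycles, together with the fixed points, lie in pairwise
   distinct cycles. *)
have cX : (#|X| + (#|T| - #|K|) <= #|porbits s|)%N.
  have -> : (#|T| - #|K| = #|~: K|)%N by rewrite [RHS]cardsCs setCK.
  rewrite -cardsUI [X :&: _](_ : _ = set0) ?cards0 ?addn0; last first.
    by apply/setP=> z; rewrite !inE; case: (s z == z); rewrite ?andbF.
  rewrite -(card_in_imset (f := porbit s)); last first.
    have repX x : x \in X :|: ~: K -> rep x = x.
      rewrite in_setU in_setC => /orP[|xK]; first by rewrite inE => /andP[_ /eqP].
      by have := rep_in x; rewrite fixP // inE => /eqP.
    by move=> x y xX yX /= e; rewrite -(repX x) // -(repX y) //; apply: rep_eq.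
  by apply: subset_leq_card; apply/subsetP=> _ /imsetP[x _ ->]; apply: imset_f.
have cK : (#|K| <= #|T|)%N by apply: max_card.
exists #|X|; last first.
  have leN : (#|porbits s| <= #|T|)%N by apply: leq_imset_card.
  by have := perm_len_le s; move: cX cK leN; clear; lia.
(* Outside [X] the value is set to the default [x0], so that [F] lands in the maps counted by
   [card_pffun_on]. *)
pose F (g : {perm T}) : {ffun T -> T} := [ffun x => if x \in X then g x else x0].
rewrite -(card_pffun_on x0 (mem X) (mem K)).
rewrite -(card_in_imset (f := F)) => [|g h /setIP[gK gC] /setIP[hK hC] eF].
  apply: subset_leq_card; apply/subsetP=> _ /imsetP[g /setIP[gK _] ->].
  apply/pffun_onP; split.
    by apply/subsetP=> x; rewrite inE /= ffunE; case: (x \in X) => //; rewrite eqxx.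
  move=> _ /imageP[x xX ->]; rewrite ffunE ifT ?Sym_mem //.
  by move: xX; rewrite inE => /andP[].
apply/permP=> z; have [zK|zK] := boolP (z \in K); last by rewrite !(Sym_out _ zK).
have /porbitP[i zi] : z \in porbit s (rep z) by rewrite porbit_sym.
have rX : rep z \in X.
  rewrite inE repK eqxx andbT; apply: contraTT zK => rK.
  have := rep_in z; rewrite porbit_sym (fixP _ rK) inE => /eqP ->.
  exact: rK.
have cm u : u \in ('C[s])%g -> u ((s ^+ i)%g (rep z)) = (s ^+ i)%g (u (rep z)).
  move=> /cent1P cus; have : commute u (s ^+ i)%g by apply: commuteX.
  by move=> e; rewrite -!permM e.
rewrite {1 2}zi !cm //; congr ((s ^+ i)%g _).
by move/ffunP/(_ (rep z)): eF; rewrite !ffunE rX.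
Qed.

End PermCounts.

(** * Character bounds *)

(** The block sum is thus the image of one element of the group algebra, on which every character of
    [Sym K0] can be evaluated additively. *)
Lemma gring_op_block_sum (T : finType) (K0 : {set T}) fuel ks d
    (rG : mx_representation algC (Sym K0) d) : {subset ks <= K0} ->
  gring_op rG (block_sum (regular_repr algC (Sym K0)) fuel ks) = block_sum rG fuel ks.
Proof.
elim: fuel ks d rG => [|fuel IH] ks d rG sk; first exact: gring_op1.
case: ks => [|y0 ks'] in sk *; first exact: gring_op1.
set aG := regular_repr _ _; set ks := y0 :: ks' in sk *.
have E d' (f : {perm T} -> 'M[algC]_d') :
    block_sum f fuel.+1 ks = \sum_(t < size ks | (size ks <= 6 * t.+1 ^ 2)%N) \sum_(eps : bool)
      sym_proj f eps [set z in take t.+1 ks] *m block_sum f fuel (drop t.+1 ks) by [].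
rewrite !E; clearbody ks; rewrite linear_sum; apply: eq_bigr => t _.
rewrite linear_sum; apply: eq_bigr => eps _ /=.
have skd : {subset drop t.+1 ks <= K0} by move=> z /mem_drop; apply: sk.
set B := block_sum aG _ _; have eB : B = gring_mx aG (gring_row B) by rewrite -gring_opE IH.
rewrite {1}eB gring_opJ -gring_opE IH //; congr (_ *m _).
rewrite /sym_proj linearZ /=; congr (_ *: _); rewrite linear_sum; apply: eq_bigr => h hA.
rewrite linearZ /= gring_opG //; apply: (subsetP (SymS _)) hA.
by apply/subsetP=> z; rewrite inE => /mem_take; apply: sk.
Qed.

Section CharacterBound.
Variables (T : finType) (d : nat).
Variable rG : mx_representation algC [set: {perm T}]%G d.
Variable c : nat.
Hypothesis small : forall eps (A : {set T}), (c.+1 < #|A|)%N -> sym_sum rG eps A = 0.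

(** Every irreducible character of [Sym K] takes a value at least 1 on [Theta], so the value of the
    restricted character there dominates the number of constituents, and [block_sum_le] bounds it.
    The centralizer enters through the second orthogonality relation. *)
Lemma character_bound (s : {perm T}) (k := supp_size s) :
  `|\tr (rG s)| <= sqrtC #|'C_(Sym [set x | s x != x])[s]%g|%:R
     * (d%:R * (36 ^+ k * \prod_(j < k) growth c (#|T| - k) j)).
Proof.
set K := [set x | s x != x]; set H := Sym K.
have sH : s \in H by rewrite in_Sym; apply/subsetP=> x; rewrite !inE.
(* Two restrictions are used: [rK] carries the character to be decomposed over [Sym K], while [rT]
   lets the upper bound use all points of [T] as the ambient set. *)
pose rK := subg_repr rG (subsetT H).
pose rT := subg_repr rG (subsetT (Sym [set: T])).
pose ks := enum K.
have szk : size ks = k by rewrite -cardE.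
have sk : {subset ks <= K} by move=> z; rewrite mem_enum.
pose phi := cfRepr rK; pose Theta := block_sum (regular_repr algC H) k ks.
have phi_s : \tr (rG s) = phi s by rewrite cfunE sH.
have phi_T : phi.[Theta]%CF <= d%:R * (36 ^+ k * \prod_(j < k) growth c (#|T| - k) j).
  rewrite xcfun_repr gring_op_block_sum //.
  have -> : block_sum rK k ks = 1%:M *m block_sum rT k ks by rewrite mul1mx.
  have smallT eps (A : {set T}) : A \subset [set: T] -> (c.+1 < #|A|)%N ->
    sym_sum rT eps A = 0 by move=> _; apply: small.
  have uks : uniq ks by apply: enum_uniq.
  have skT : {subset ks <= [set: T]} by move=> z _; rewrite inE.
  have := block_sum_le smallT (eq_leq szk) (subxx _) uks skT (mul1mx _)
    (fun g _ => comm_mx_sym (comm_mx1 _)).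
  by rewrite mxtrace1 szk cardsT.
have m_nat i : '[phi, 'chi_i] \in Num.nat by apply/Cnat_cfdot_char_irr/cfRepr_char.
have m_ge0 i : 0 <= '[phi, 'chi_i] by apply: natr_ge0.
have chi_T i : 1 <= ('chi[H]_i).[Theta]%CF.
  rewrite -irrRepr xcfun_repr gring_op_block_sum // -[block_sum _ _ _]mul1mx.
  have := block_sum_ge (rG := 'Chi_i) (eq_leq szk) (enum_uniq _) sk (mul1mx _)
    (fun g _ => comm_mx_sym (comm_mx1 _)).
  by rewrite -mxrank_eq0 mxrank1 -lt0n irr_degree_gt0.
have chi_s i : `|'chi[H]_i s| <= sqrtC #|'C_H[s]%g|%:R.
  rewrite -(@ler_pXn2r _ 2) ?nnegrE ?normr_ge0 ?sqrtC_ge0 ?ler0n //.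
  have := second_orthogonality_relation s sH; rewrite class_refl mulr1n sqrtCK => <-.
  rewrite (bigD1 i) //= -normCK lerDl sumr_ge0 // => j _; exact: mul_conjC_ge0.
have eT : phi.[Theta]%CF = \sum_i '[phi, 'chi_i] * ('chi_i).[Theta]%CF.
  rewrite {1}[phi]cfun_sum_cfdot -xcfun_rE raddf_sum; apply: eq_bigr => i _.
  by rewrite /= xcfunZl.
rewrite phi_s {1}[phi]cfun_sum_cfdot sum_cfunE.
apply: le_trans (ler_norm_sum _ _ _) _.
apply: le_trans (_ : \sum_i '[phi, 'chi_i] * sqrtC #|'C_H[s]%g|%:R <= _).
  apply: ler_sum => i _; rewrite cfunE normrM ger0_norm // ler_wpM2l //.
rewrite -mulr_suml mulrC ler_wpM2l ?sqrtC_ge0 ?ler0n //.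
apply: le_trans phi_T; rewrite eT; apply: ler_sum => i _.
by rewrite ler_peMr.
Qed.

End CharacterBound.

(** * Assembly of the estimates *)

Lemma prod_growth_le c n k : (0 < k <= n)%N ->
  \prod_(j < k) growth c (n - k) j <= (4 * ((sqrtC k%:R)^-1 + c%:R / n%:R)) ^+ k.
Proof.
move=> /andP[k0 kn]; have n0 : (0 < n)%N := leq_trans k0 kn.
have k0' : 0 < k%:R :> algC by rewrite ltr0n.
have n0' : 0 < n%:R :> algC by rewrite ltr0n.
have sk0 : 0 < sqrtC k%:R :> algC by rewrite sqrtC_gt0.
set B := _ + _; have B0 : 0 <= B by rewrite addr_ge0 ?divr_ge0 ?invr_ge0 ?ler0n // ltW.
(* Each factor costs at most [k / (j + 1)] relative to [B], and the product of these ratios is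
   [k ^ k / k!], at most [4 ^ k]. *)
have step (j : 'I_k) : growth c (n - k) j <= k%:R / (j.+1)%:R * B.
  have j0 : 0 < (j.+1)%:R :> algC by rewrite ltr0n.
  have sj0 : 0 < sqrtC (j.+1)%:R :> algC by rewrite sqrtC_gt0.
  have jk : (j < k)%N := ltn_ord j.
  rewrite /growth /B mulrDr; apply: lerD.
    have -> : k%:R / (j.+1)%:R / sqrtC k%:R
        = sqrtC k%:R / sqrtC (j.+1)%:R * (sqrtC (j.+1)%:R)^-1 :> algC.
      rewrite -{1}[k%:R]sqrtCK -{1}[(j.+1)%:R]sqrtCK.
      move: (lt0r_neq0 sk0) (lt0r_neq0 sj0).
      by move: (sqrtC _) (sqrtC _) => x y x0 y0; field; rewrite x0 y0.
    rewrite ler_peMl ?invr_ge0 ?(ltW sj0) // ler_pdivlMr // mul1r.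
    by rewrite -(@ler_pXn2r _ 2) ?nnegrE ?(ltW sk0) ?(ltW sj0) // !sqrtCK ler_nat.
  have e0 : 0 < (n - k + j.+1)%:R :> algC by rewrite ltr0n addnS.
  rewrite ler_pdivrMr //.
  have -> : k%:R / (j.+1)%:R * (c%:R / n%:R) * (n - k + j.+1)%:R
      = c%:R * ((k * (n - k + j.+1))%:R / (j.+1 * n)%:R) :> algC.
    rewrite !natrM; move: (_ + _)%:R (lt0r_neq0 j0) (lt0r_neq0 n0') => E.
    by move: j.+1%:R n%:R => x y x0 y0; field; rewrite x0 y0.
  rewrite ler_peMr ?ler0n // ler_pdivlMr ?ltr0n ?muln_gt0 // mul1r ler_nat.
  by move: jk kn; clear; nia.
apply: le_trans (_ : \prod_(j < k) (k%:R / (j.+1)%:R * B) <= _).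
  by apply: ler_prod => j _; rewrite growth_ge0 step.
rewrite big_split /= prodr_const card_ord exprMn ler_wpM2r ?exprn_ge0 //.
rewrite big_split /= prodr_const card_ord prodfV -natr_prod.
rewrite (_ : \prod_(j < k) j.+1 = k`!)%N; last first.
  by rewrite fact_prod big_add1 big_mkord.
by rewrite ler_pdivrMr ?ltr0n ?fact_gt0 // -!natrX -natrM ler_nat expnn_le_fact.
Qed.

Theorem theorem1p1 :
  exists (C0 : algC) (n0 : nat),
    [/\ 0 < C0, (1 <= n0)%N &
      forall n : nat, (n0 <= n)%N ->
      forall la : seq nat, is_part n la ->
      forall s : 'S_n, s != 1%g ->
        `|norm_char la s|
          <= (C0 / sqrtC (perm_len s)%:R) ^+ perm_len s
             * Num.max 1 ((max_hook la)%:R * sqrtC (perm_len s)%:R / n%:R)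
               ^+ supp_size s].
Proof.
(* 432 = 36 * 4 * 3, with 36 from [block_sum_le], 4 from [prod_growth_le] and 3 from the comparison
   with [M]. The square converts the exponent [k] into [m], as [k <= 2 * m]. *)
exists (432 ^+ 2), 1%N; split=> //; first by rewrite exprn_gt0 ?ltr0n.
move=> n n0 la la_part s s1; set m := perm_len s; set k := supp_size s.
set M := Num.max _ _; set h := max_hook la; set d := specht_dim n la.
have n0' : 0 < n%:R :> algC by rewrite ltr0n.
have k2m : (k <= 2 * m)%N by apply: supp_le_perm_len.
have k0 : (0 < k)%N.
  rewrite /k /supp_size card_gt0; apply: contra_neq s1 => s0; apply/permP=> x.
  apply/eqP; have := in_set0 x; rewrite -s0 inE perm1 => /negbT; rewrite negbK.
  by [].
have m0 : (0 < m)%N by move: k0 k2m; clear; lia.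
have kn : (k <= n)%N by rewrite -[n in (_ <= n)%N]card_ord; apply: max_card.
have sm0 : 0 < sqrtC m%:R :> algC by rewrite sqrtC_gt0 ltr0n.
have sk0 : 0 < sqrtC k%:R :> algC by rewrite sqrtC_gt0 ltr0n.
have t0 : 0 <= h%:R * sqrtC m%:R / n%:R :> algC.
  by rewrite divr_ge0 ?mulr_ge0 ?ler0n // ltW.
(* [Num.max] over the partially ordered [algC] behaves as expected only on comparable arguments;
   here both are real. *)
have tR : h%:R * sqrtC m%:R / n%:R \is Num.real := ger0_real t0.
have [M1 Mt] : 1 <= M /\ h%:R * sqrtC m%:R / n%:R <= M.
  by rewrite /M !comparable_le_max ?real_comparable // !lexx orbT.
have M0 : 0 <= M := le_trans ler01 M1.
have rhs0 : 0 <= (432 ^+ 2 / sqrtC m%:R) ^+ m * M ^+ k.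
  by rewrite mulr_ge0 ?exprn_ge0 // divr_ge0 ?exprn_ge0 ?ler0n // ltW.
(* In dimension 0 the quotient is 0 by the convention on inverses. *)
rewrite /norm_char -/d; have [d0|d0] := posnP d.
  by rewrite d0 invr0 mulr0 normr0.
have d0' : 0 < d%:R :> algC by rewrite ltr0n.
pose c := (maxn (head 0%N la) (size la)).-1.
have ch : (c <= h)%N.
  by rewrite /c /h /max_hook; move: (head _ _) (size _); clear; lia.
have sz eps (A : {set 'I_n}) : (c.+1 < #|A|)%N -> sym_sum (specht_repr n la) eps A = 0.
  exact: specht_sym_sum0.
have := character_bound sz s; rewrite -/k card_ord.
have -> : \tr (specht_repr n la s) = specht_char n la s by rewrite cfunE inE.
have [p Cp pk] := card_centralizer s1; rewrite -/k -/m in Cp pk.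
set C := #|_| in Cp *; rewrite -/(specht_dim n la) -/d => bound.
set a := sqrtC k%:R in sk0 *; set b := sqrtC m%:R in sm0 *.
have a1 : 1 <= a by rewrite -sqrtC1 ler_sqrtC ?ler1n ?nnegrE ?ler0n.
have mk : (m <= k)%N by move: pk; clear; lia.
have ba : b <= a by rewrite ler_sqrtC ?nnegrE ?ler0n // ler_nat.
have a2b : a <= 2 * b.
  rewrite -(@ler_pXn2r _ 2) ?nnegrE ?mulr_ge0 ?(ltW sk0) ?(ltW sm0) ?ler0n //.
  by rewrite exprMn !sqrtCK -natrX -natrM ler_nat; move: k2m; clear; lia.
have C_le : sqrtC C%:R <= a ^+ p.
  by rewrite -rootCX ?ler0n // ler_sqrtC ?nnegrE ?exprn_ge0 ?ler0n // -natrX ler_nat.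
have P_le : \prod_(j < k) growth c (n - k) j <= (4 * (a^-1 * (3 * M))) ^+ k.
  apply: le_trans (prod_growth_le c (n := n) _) _; first by rewrite k0.
  have B0 : 0 <= a^-1 + c%:R / n%:R by rewrite addr_ge0 ?divr_ge0 ?invr_ge0 ?ler0n // ltW.
  rewrite lerXn2r ?nnegrE ?mulr_ge0 ?ler0n ?invr_ge0 ?(ltW sk0) // ler_wpM2l ?ler0n //.
  have -> : a^-1 + c%:R / n%:R = a^-1 * (1 + c%:R * a / n%:R).
    by rewrite mulrDr mulr1 -mulrA [_ * (a / _)]mulrCA mulKf // gt_eqF.
  rewrite ler_wpM2l ?invr_ge0 ?(ltW sk0) //.
  (* The summand 1 is at most [M]; the other is at most [2 * M] because [c <= h] and
     [a <= 2 * b]. *)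
  have -> : 3 * M = M + 2 * M by rewrite -{2}[M]mul1r -mulrDl -(natrD _ 1 2).
  rewrite lerD // (le_trans _ (ler_wpM2l (ler0n _ 2) Mt)) // mulrA.
  rewrite ler_wpM2r ?invr_ge0 ?ler0n // mulrCA.
  by apply: ler_pM; rewrite ?ler0n ?(ltW sk0) // ler_nat.
rewrite normrM normfV (ger0_norm (ltW d0')) ler_pdivrMr //.
apply: le_trans bound _; rewrite mulrCA mulrC ler_wpM2r ?ler0n //.
have P0 : 0 <= \prod_(j < k) growth c (n - k) j.
  by apply: prodr_ge0 => j _; apply: growth_ge0.
apply: le_trans (_ : a ^+ p * (36 ^+ k * (4 * (a^-1 * (3 * M))) ^+ k) <= _).
  by apply: ler_pM; rewrite ?sqrtC_ge0 ?ler0n ?mulr_ge0 ?exprn_ge0 ?ler0n // ler_wpM2l ?exprn_ge0 ?ler0n.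
have -> : a ^+ p * (36 ^+ k * (4 * (a^-1 * (3 * M))) ^+ k) = (a ^+ p / a ^+ k) * 432 ^+ k * M ^+ k.
  rewrite -!exprMn.
  have -> : 36 * (4 * (a^-1 * (3 * M))) = a^-1 * (432 * M).
    have -> : (432 : algC) = 36 * (4 * 3) by rewrite -!natrM.
    ring.
  by rewrite !exprMn exprVn !mulrA.
rewrite ler_wpM2r ?exprn_ge0 // exprMn -exprM exprVn [X in _ <= X]mulrC.
apply: ler_pM; rewrite ?divr_ge0 ?exprn_ge0 ?(ltW sk0) ?ler0n //; last first.
  by apply: ler_weXn2l; rewrite ?ler1n.
(* From [b <= a], [1 <= a] and [p + m <= k] follows [a ^+ p * b ^+ m <= a ^+ (p + m) <= a ^+ k]:
   after the centralizer is paid for, a factor [b ^- m] remains. *)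
rewrite ler_pdivrMr ?exprn_gt0 // mulrC ler_pdivlMr ?exprn_gt0 //.
apply: le_trans (_ : a ^+ p * a ^+ m <= _).
  by rewrite ler_wpM2l ?exprn_ge0 ?(ltW sk0) // lerXn2r ?nnegrE ?(ltW sk0) ?(ltW sm0).
by rewrite -exprD; apply: ler_weXn2l.
Qed.
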